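(* Let $\pi$ be a probability density and $q$ a proposal density on $\mathbb{R}^d$ satisfying the target and proposal assumptions given in the context (with exponent $m\in(0,1)$), and let $P$ be the transition kernel of the symmetric random walk Hastings–Metropolis algorithm with target $\pi$ and increment density $q$. Then there exist $z_*>0$, $c>0$ and $z>0$ such that, with $V:=\pi^{-z_*}$, any probability measure $\lambda$ on $\mathbb{R}^d$ satisfying $\lambda(V)<\infty$ is $(f,r)$-regular for $P$ with $$r(n)=e^{c\,n^{m/(2-m)}}\qquad\text{and}\qquad f=\pi^{-z}.$$
   Context: $|\cdot|$ and $\langle\cdot,\cdot\rangle$ are the Euclidean norm and scalar product (and $|\cdot|$ a norm on matrices); $\nabla$ and $\nabla^2$ denote gradient and Hessian; $\mu_d$ is Lebesgue measure on $\mathbb{R}^d$. Metropolis kernel: with $\alpha(x,y)=\min\{\pi(y)/\pi(x),1\}$ if $\pi(x)>0$ and $\alpha(x,y)=1$ if $\pi(x)=0$, $$P(x,A)=\int_{\mathbb{R}^d}\mathbf{1}_A(x+y)\,\alpha(x,x+y)\,q(y)\,d\mu_d(y)+\mathbf{1}_A(x)\int_{\mathbb{R}^d}\bigl(1-\alpha(x,x+y)\bigr)q(y)\,d\mu_d(y).$$ Target assumption: $\pi$ is continuous and positive on $\mathbb{R}^d$ and there exist $m\in(0,1)$, $r_0\in(0,1)$, positive constants $d_i,D_i$, $i=0,1,2$, and $R_0<\infty$ such that on $\{|x|\ge R_0\}$, $\pi$ is twice continuously differentiable and $$\Bigl\langle\frac{\nabla\pi(x)}{|\nabla\pi(x)|},\frac{x}{|x|}\Bigr\rangle\le-r_0,\qquad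 d_0|x|^m\le-\log\pi(x)\le D_0|x|^m,$$ $$d_1|x|^{m-1}\le|\nabla\log\pi(x)|\le D_1|x|^{m-1},\qquad d_2|x|^{m-2}\le|\nabla^2\log\pi(x)|\le D_2|x|^{m-2}.$$ Proposal assumption: $q$ is a symmetric probability density with respect to $\mu_d$, bounded away from zero in a neighborhood of $0$, and compactly supported, i.e. there is $c(q)$ such that $q(y)=0$ for $|y|\ge c(q)$. Under these assumptions the chain $(\Phi_n)$ with kernel $P$ is $\psi$-irreducible and aperiodic, $\psi$ denoting a maximal irreducibility measure. With $\tau_B=\inf\{n\ge1:\Phi_n\in B\}$, a probability measure $\lambda$ is $(f,r)$-regular if $\mathbb{E}_\lambda\bigl[\sum_{k=0}^{\tau_B-1}r(k)f(\Phi_k)\bigr]<\infty$ for every Borel set $B$ with $\psi(B)>0$, where $\mathbb{E}_\lambda$ is expectation for $\Phi_0\sim\lambda$. *)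

(* Defs.v *)
From HB Require Import structures.
From mathcomp Require Import all_boot all_order all_algebra.
From mathcomp Require Import all_classical all_reals all_analysis.
From mathcomp Require Import measurable_realfun.

Set Implicit Arguments.
Unset Strict Implicit.
Unset Printing Implicit Defensive.

Import Order.TTheory GRing.Theory Num.Theory.
Import numFieldNormedType.Exports.

Local Open Scope classical_set_scope.
Local Open Scope ring_scope.

Definition rV_display : measure_display -> measure_display.
Proof. exact. Qed.

Section borel_rV.
Context {R : realType} {n : nat}.

Definition borel_rV : set (set 'rV[R]_n) := <<s [set U | open U] >>.

Let borel_rV0 : borel_rV set0. Proof. exact: sigma_algebra0. Qed.

Let borel_rVC A : borel_rV A -> borel_rV (~` A).
Proof. exact: sigma_algebraC. Qed.

Let borel_rV_bigcup (F : (set 'rV[R]_n)^nat) :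
  (forall i, borel_rV (F i)) -> borel_rV (\bigcup_i F i).
Proof. exact: sigma_algebra_bigcup. Qed.

HB.instance Definition _ := @isMeasurable.Build
  (rV_display default_measure_display) 'rV[R]_n
  borel_rV borel_rV0 borel_rVC borel_rV_bigcup.

End borel_rV.

Section measurable_rV.
Context {R : realType}.

Lemma open_measurable_rV n (U : set 'rV[R]_n) : open U -> measurable U.
Proof. by move=> oU; exact: sub_sigma_algebra. Qed.

Lemma measurable_coord_rV n (i : 'I_n) :
  measurable_fun setT (fun v : 'rV[R]_n => v 0 i).
Proof.
apply: (@measurability _ _ _ _ _ _ (@RGenOpens.G R)).
  exact: RGenOpens.measurableE.
move=> _ [_ [a [b ->]] <-].
rewrite setTI; apply: open_measurable_rV; apply: open_comp.
  by move=> v _; exact: coord_continuous.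
exact: interval_open.
Qed.

Lemma measurable_fun_rV d (T : measurableType d) n (h : T -> 'rV[R]_n) :
  (forall i, measurable_fun setT (fun t => h t 0 i)) -> measurable_fun setT h.
Proof.
move=> mh; apply: (@measurability _ _ _ _ setT h [set U | open U]) => //.
move=> _ [U oU <-]; rewrite setTI.
pose box (rq : 'rV[rat]_n * rat) : set 'rV[R]_n :=
  [set v | forall i, `|v 0 i - ratr (rq.1 0 i)| < ratr rq.2].
have -> : U = \bigcup_(rq in [set rq | box rq `<=` U]) box rq.
  apply/seteqP; split=> [v Uv|v [rq /= + brq]]; last exact.
  have /nbhs_ballP[e /= e0 eU] : nbhs v U by exact: open_nbhs_nbhs.
  have e20 : 0 < e / 2 by rewrite divr_gt0.
  have [q /= /[!in_itv]/= /andP[q0 qe]] := rat_in_itvoo e20.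
  have Hr i : exists r : rat, `|v 0 i - ratr r| < ratr q.
    have : v 0 i - ratr q < v 0 i + ratr q.
      by rewrite ltrD2l (lt_trans _ q0)// oppr_lt0.
    move=> /rat_in_itvoo[r /[!in_itv]/= rI].
    by exists r; rewrite distrC ltr_distl.
  have {Hr}[r Hr] := choice Hr.
  exists (\row_i r i, q); last by move=> i /=; rewrite mxE.
  move=> w /= wr; apply: eU; split => // i j; rewrite (ord1 i).
  rewrite /ball/= (splitr e) (le_lt_trans (ler_distD (ratr (r j)) _ _))//.
  rewrite ltrD// ?(lt_trans (Hr j))// distrC (lt_trans _ qe)//.
  by have := wr j; rewrite mxE.
rewrite preimage_bigcup.
rewrite bigcup_mkcond; apply: countable_bigcupT_measurable => // -[r q].
case: ifPn => // _.
have -> : h @^-1` box (r, q) = \bigcap_(i in [set: 'I_n])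
    ((fun t => h t 0 i) @^-1` `]ratr (r 0 i) - ratr q, ratr (r 0 i) + ratr q[).
  apply/seteqP; split=> [t ht i _|t ht i] /=.
    by rewrite in_itv/= -ltr_distl; exact: ht.
  by have := ht i I; rewrite /= in_itv/= -ltr_distl.
apply: fin_bigcap_measurable; first exact: finite_finset.
by move=> i _; rewrite -[X in measurable X]setTI; apply: mh.
Qed.

End measurable_rV.

Lemma sigma_finite_product d1 d2 (T1 : measurableType d1)
    (T2 : measurableType d2) (R : realType)
    (m1 : {sigma_finite_measure set T1 -> \bar R})
    (m2 : {sigma_finite_measure set T2 -> \bar R}) :
  sigma_finite setT (m1 \x m2)%E.
Proof.
have /sigma_finiteP[F [TF ndF Foo]] := sigma_finiteT m1.
have /sigma_finiteP[G [TG ndG Goo]] := sigma_finiteT m2.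
exists (fun k => F k `*` G k).
  rewrite -setXTT TF TG predeqE => -[x y]; split.
    move=> [/= [k _ Fkx] [l _ Gly]]; exists (maxn k l) => //; split.
    - by move: x Fkx; exact/subsetPset/ndF/leq_maxl.
    - by move: y Gly; exact/subsetPset/ndG/leq_maxr.
  by move=> [k _ []/= ? ?]; split; exists k.
move=> k; have [? ?] := Foo k; have [? ?] := Goo k.
split; first exact: measurableX.
by rewrite product_measure1E// lte_mul_pinfty// ge0_fin_numE.
Qed.

Section cons_rV.
Context {R : realType} (n : nat).

Definition cons_rV (p : R * 'rV[R]_n) : 'rV[R]_n.+1 :=
  \row_i (if unlift 0 i is Some j then p.2 0 j else p.1).

Definition uncons_rV (v : 'rV[R]_n.+1) : R * 'rV[R]_n :=
  (v 0 0, \row_i v 0 (lift 0 i)).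

Lemma cons_rV0 p : cons_rV p 0 0 = p.1.
Proof. by rewrite mxE unlift_none. Qed.

Lemma cons_rVS p i : cons_rV p 0 (lift 0 i) = p.2 0 i.
Proof. by rewrite mxE liftK. Qed.

Lemma cons_rVK : cancel cons_rV uncons_rV.
Proof.
move=> [x v]; congr pair; first by rewrite cons_rV0.
by apply/rowP => i; rewrite mxE cons_rVS.
Qed.

Lemma measurable_cons_rV : measurable_fun setT cons_rV.
Proof.
apply: measurable_fun_rV => i; case: (unliftP 0 i) => [j ->|->].
- under eq_fun do rewrite cons_rVS.
  by apply: (measurableT_comp (measurable_coord_rV j)); exact: measurable_snd.
- by under eq_fun do rewrite cons_rV0; exact: measurable_fst.
Qed.

Lemma measurable_uncons_rV : measurable_fun setT uncons_rV.
Proof.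
apply/measurable_fun_pairP; split; first exact: measurable_coord_rV.
apply: measurable_fun_rV => i; under eq_fun do rewrite mxE.
exact: measurable_coord_rV.
Qed.

Variable mu : {sigma_finite_measure set 'rV[R]_n -> \bar R}.

Definition lebesgue_cons : set 'rV[R]_n.+1 -> \bar R :=
  pushforward (@lebesgue_measure R \x mu)%E cons_rV.

Let lebesgue_cons0 : lebesgue_cons set0 = 0%E.
Proof. by rewrite /lebesgue_cons /pushforward preimage_set0 measure0. Qed.

Let lebesgue_cons_ge0 A : (0 <= lebesgue_cons A)%E.
Proof. by apply: measure_ge0; exact: measurable_cons_rV. Qed.

Let lebesgue_cons_sigma_additive : semi_sigma_additive lebesgue_cons.
Proof.
apply: measure_semi_sigma_additive.
exact: measurable_cons_rV.
Qed.

HB.instance Definition _ := isMeasure.Build _ _ _ lebesgue_cons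
  lebesgue_cons0 lebesgue_cons_ge0 lebesgue_cons_sigma_additive.

Let lebesgue_cons_sigma_finite : sigma_finite setT lebesgue_cons.
Proof.
have [F FT Ffin] := sigma_finite_product (@lebesgue_measure R) mu.
exists (fun k => uncons_rV @^-1` F k).
  by rewrite -preimage_bigcup -FT preimage_setT.
move=> k; have [mF Fk] := Ffin k; split.
  by rewrite -[X in measurable X]setTI; exact: measurable_uncons_rV.
rewrite /lebesgue_cons /pushforward -comp_preimage.
by rewrite (_ : uncons_rV \o cons_rV = id)//; apply/funext => p; exact: cons_rVK.
Qed.

HB.instance Definition _ := Measure_isSigmaFinite.Build _ _ _ lebesgue_cons
  lebesgue_cons_sigma_finite.

End cons_rV.

Fixpoint lebesgue_rV (R : realType) (n : nat) :
    {sigma_finite_measure set 'rV[R]_n -> \bar R} :=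
  if n is k.+1 then lebesgue_cons (lebesgue_rV R k) else dirac (0 : 'rV[R]_0).

Lemma lebesgue_rV_box (R : realType) n (A : 'I_n -> set R) :
  (forall i, measurable (A i)) ->
  lebesgue_rV R n [set v : 'rV[R]_n | forall i, A i (v 0 i)] =
  (\prod_i lebesgue_measure (A i))%E.
Proof.
elim: n A => [|n ih] A mA /=.
  by rewrite big_ord0 diracE mem_set// => -[].
have mB : measurable [set v : 'rV[R]_n | forall i, A (lift 0 i) (v 0 i)].
  have -> : [set v : 'rV[R]_n | forall i, A (lift 0 i) (v 0 i)] =
      \bigcap_(i in [set: 'I_n]) ((fun v => v 0 i) @^-1` A (lift 0 i)).
    by apply/seteqP; split=> [v vA i _|v vA i]; [exact: vA|exact: (vA i I)].
  apply: fin_bigcap_measurable; first exact: finite_finset.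
  move=> i _; rewrite -[X in measurable X]setTI.
  exact: measurable_coord_rV.
rewrite big_ord_recl -(ih (fun i => A (lift 0 i)))//.
transitivity ((@lebesgue_measure R \x lebesgue_rV R n)%E
    (A 0 `*` [set v : 'rV[R]_n | forall i, A (lift 0 i) (v 0 i)])); last first.
  exact: etrans (@product_measure1E _ _ _ _ _
    (@lebesgue_measure R) (lebesgue_rV R n) _ _ (mA 0) mB) _.
rewrite /lebesgue_cons /pushforward; congr (product_measure1 _ _ _).
apply/seteqP; split=> [p pA|p [p0 pS] i].
  split=> [|i]; first by have := pA 0; rewrite cons_rV0.
  by have := pA (lift 0 i); rewrite cons_rVS.
by case: (unliftP 0 i) => [j ->|->]; rewrite ?cons_rV0// cons_rVS; exact: pS.
Qed.

Section euclidean.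
Context {R : realType} {n : nat}.
Implicit Types (x y : 'rV[R]_n) (f : 'rV[R]_n -> R).

Definition dotrv x y : R := \sum_i x 0 i * y 0 i.

Definition enorm x : R := Num.sqrt (dotrv x x).

Definition partial (i : 'I_n) f : 'rV[R]_n -> R := 'D_(delta_mx 0 i) f.

Definition gradient f x : 'rV[R]_n := \row_i partial i f x.

Definition hessian f x : 'M[R]_n := \matrix_(i, j) partial j (partial i f) x.

(** To be used for an open set [U]. *)
Definition C2_on (U : set 'rV[R]_n) f : Prop := forall x, U x ->
  [/\ differentiable f x,
      forall i, differentiable (partial i f) x &
      forall i j, {for x, continuous (partial j (partial i f))}].

Definition is_density f : Prop :=
  [/\ measurable_fun setT f, forall x, 0 <= f x &
      (\int[lebesgue_rV R n]_x (f x)%:E = 1)%E].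

End euclidean.

Section assumptions.
Context {R : realType} {n : nat}.

(** The norm on Hessians is the one of the library, the maximum of the absolute
    values of the entries; all norms on matrices yield the same assumption
    since [d2] and [D2] are existentially quantified. *)
Definition target_assumption (m : R) (pi : 'rV[R]_n -> R) : Prop :=
  [/\ continuous pi,
      forall x, 0 < pi x &
      exists r0 d0 D0 d1 D1 d2 D2 R0 : R,
      [/\ 0 < r0 < 1,
          [/\ 0 < d0 /\ 0 < D0, 0 < d1 /\ 0 < D1 & 0 < d2 /\ 0 < D2],
          exists2 U : set 'rV[R]_n, open U /\ [set x | R0 <= enorm x] `<=` U &
            C2_on U pi &
          forall x, R0 <= enorm x ->
          let logpi := fun y => ln (pi y) in
          [/\ dotrv ((enorm (gradient pi x))^-1 *: gradient pi x)
                    ((enorm x)^-1 *: x) <= - r0,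
              d0 * enorm x `^ m <= - ln (pi x) <= D0 * enorm x `^ m,
              d1 * enorm x `^ (m - 1) <= enorm (gradient logpi x)
                <= D1 * enorm x `^ (m - 1) &
              d2 * enorm x `^ (m - 2) <= `|hessian logpi x|
                <= D2 * enorm x `^ (m - 2)]]].

Definition proposal_assumption (q : 'rV[R]_n -> R) : Prop :=
  [/\ is_density q,
      forall y, q (- y) = q y,
      exists2 eps : R, 0 < eps & \forall y \near (0 : 'rV[R]_n), eps <= q y &
      exists cq : R, forall y, cq <= enorm y -> q y = 0].

End assumptions.

Section metropolis.
Context {R : realType} {n : nat}.
Implicit Types (pi q : 'rV[R]_n -> R).

Definition acceptance pi (x y : 'rV[R]_n) : R :=
  if 0 < pi x then Num.min (pi y / pi x) 1 else 1.

Definition metropolis pi q (x : 'rV[R]_n) (A : set 'rV[R]_n) : \bar R :=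
  ((\int[lebesgue_rV R n]_y
      (\1_A (x + y) * acceptance pi x (x + y) * q y)%:E)
   + (\1_A x)%:E *
     (\int[lebesgue_rV R n]_y ((1 - acceptance pi x (x + y)) * q y)%:E))%E.

Definition is_metropolis_kernel pi q (P : R.-pker 'rV[R]_n ~> 'rV[R]_n) : Prop :=
  forall x A, measurable A -> P x A = metropolis pi q x A.

End metropolis.

Section markov.
Context {R : realType} {d : measure_display} {T : measurableType d}.
Variable P : R.-pker T ~> T.

Fixpoint kernel_iter (k : nat) (x : T) (A : set T) : \bar R :=
  if k is k'.+1 then (\int[P x]_y kernel_iter k' y A)%E else \d_x A.

Definition irreducibility_measure
    (phi : {sigma_finite_measure set T -> \bar R}) : Prop :=
  (0 < phi setT)%E /\
  forall x A, measurable A -> (0 < phi A)%E ->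
    exists2 k, (0 < k)%N & (0 < kernel_iter k x A)%E.

Definition maximal_irreducibility_measure
    (psi : {sigma_finite_measure set T -> \bar R}) : Prop :=
  irreducibility_measure psi /\
  forall phi, irreducibility_measure phi -> phi `<< psi.

(** The Markov property is with respect to the natural filtration, whose n-th
    sigma-algebra is [g_sigma_preimage (fun i : 'I_n.+1 => Phi i)]. *)
Definition markov_chain (lambda : probability T R)
    {dO : measure_display} {Omega : measurableType dO}
    (Pr : probability Omega R) (Phi : nat -> Omega -> T) : Prop :=
  [/\ forall k, measurable_fun setT (Phi k),
      forall A, measurable A -> Pr (Phi 0%N @^-1` A) = lambda A &
      forall k F A, g_sigma_preimage (fun i : 'I_k.+1 => Phi i) F ->
        measurable A ->
        Pr (F `&` Phi k.+1 @^-1` A) = (\int[Pr]_(w in F) P (Phi k w) A)%E].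

(** [+oo] when the chain never returns to [B]. *)
Definition return_time {Omega : Type} (Phi : nat -> Omega -> T) (B : set T)
    (w : Omega) : \bar R :=
  ereal_inf [set k%:R%:E | k in [set k | (0 < k)%N /\ B (Phi k w)]].

(** The expectation only depends on [lambda] and [P]; it is taken over every
    chain with this initial distribution and kernel. *)
Definition regular (f : T -> R) (r : nat -> R) (lambda : probability T R) :
    Prop :=
  forall psi, maximal_irreducibility_measure psi ->
  forall B, measurable B -> (0 < psi B)%E ->
  forall (dO : measure_display) (Omega : measurableType dO)
    (Pr : probability Omega R) (Phi : nat -> Omega -> T),
  markov_chain lambda Pr Phi ->
  (\int[Pr]_w (\sum_(0 <= k <oo | (k%:R%:E < return_time Phi B w)%E)
      (r k * f (Phi k w))%:E) < +oo)%E.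

End markov.

(* Main.v *)
Require Import Defs.
From HB Require Import structures.
From mathcomp Require Import all_boot all_order all_algebra finmap.
From mathcomp Require Import all_classical all_reals all_analysis.
From mathcomp Require Import measurable_realfun ring lra.

Set Implicit Arguments.
Unset Strict Implicit.
Unset Printing Implicit Defensive.

Import Order.TTheory GRing.Theory Num.Theory.
Import numFieldNormedType.Exports.

Local Open Scope classical_set_scope.
Local Open Scope ring_scope.

(** The potential [U = - ln pi] grows like [|x| ^ m], with a gradient of order
    [|x| ^ (m - 1)] and a Hessian of the smaller order [|x| ^ (m - 2)]. Pair the
    increments [y] and [- y]: to first order, one of them raises [U] by some
    [Delta] and the other lowers it by [Delta], but the first one is rejected
    with probability about [Delta]. Hence [U] decreases on average, by an amount
    of order [|x| ^ (2 * (m - 1))], that is of order [U ^ - (p - 1)] with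
    [p = (2 - m) / m]. Equivalently, [U ^ p] decreases at a constant rate, and for
    [A] large [tau + A * U ^ p], where [tau] is time, still decreases. With
    [s = 1 / p = m / (2 - m)] and [c] small, so that the second order terms do not
    spoil this, [expR (c * (tau + A * U ^ p) ^ s)] is a supermartingale as long as
    the chain stays far from the origin ([metropolis_drift]). Its decrease
    dominates a constant times [expR (c / 4 * tau ^ s) * pi ^ - z], which is both
    the rate and the function in the conclusion ([gain_le]).

    It remains to handle the times at which the chain is in a bounded set [C],
    until it enters [B]. A set [B] charged by an irreducibility measure has positive
    Lebesgue measure, because the transitions are absolutely continuous except for
    the rejections ([lebesgue_gt0_of_irreducible]). Therefore [B] is reached from
    [C] within a fixed number of steps with a probability bounded below
    ([survival_lt1]), and the expected number of visits to [C] before [B] is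
    bounded ([visits_le]). This number, as a function of the starting point,
    decreases by one at each visit. Multiplied by a small constant times
    [expR (c * tau ^ s)] and added to the function above, it compensates the
    defect of the latter on [C]: that defect is a vanishing proportion of
    [expR (c * tau ^ s)], as this rate is subexponential ([time_weights]). The sum
    is a supersolution for the chain killed in [B], and summing over time
    ([killed_comparison]) bounds the modulated moment by the expectation of the
    initial value of the supersolution, of order [pi ^ - zstar]. *)

(** * Real inequalities *)

Section real_inequalities.
Context {R : realType}.
Implicit Types (a b c e r s p u v x A T tau : R).

Lemma powR_antitone a b e : 0 < a -> a <= b -> e <= 0 -> b `^ e <= a `^ e.
Proof.
move=> a0 ab e0; have b0 : 0 < b by exact: lt_le_trans ab.
by rewrite /powR !gt_eqF// ler_expR ler_wnM2l// ler_ln.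
Qed.

Lemma powR_monotone a b e : 0 <= a -> a <= b -> 0 <= e -> a `^ e <= b `^ e.
Proof.
by move=> a0 ab e0; apply: ge0_ler_powR; rewrite ?nnegrE// (le_trans a0).
Qed.

Lemma powR_eventually_small e b : e < 0 -> 0 < b ->
  exists2 r0, 0 < r0 & forall r, r0 <= r -> r `^ e <= b.
Proof.
move=> e0 b0; exists (b `^ e^-1) => [|r br]; first exact: powR_gt0.
rewrite (le_trans (powR_antitone (powR_gt0 _ b0) br (ltW e0)))//.
by rewrite -powRrM mulVf ?lt_eqF// powRr1// ltW.
Qed.

Lemma powR_eventually_large e b : 0 < e ->
  exists2 r0, 0 < r0 & forall r, r0 <= r -> b <= r `^ e.
Proof.
move=> e0; have B1 : 1 <= Num.max 1 b by rewrite le_max lexx.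
have B0 : 0 < Num.max 1 b by rewrite (lt_le_trans _ B1).
exists (Num.max 1 b `^ e^-1) => [|r br]; first exact: powR_gt0.
have := powR_monotone (powR_ge0 _ _) br (ltW e0).
rewrite -powRrM mulVf ?gt_eqF// powRr1 ?(ltW B0)//.
by apply: le_trans; rewrite le_max lexx orbT.
Qed.

(** Follows from [1 - v <= expR (- v)] by inversion. *)
Lemma expR_le_quadratic v : v <= 2^-1 -> expR v <= 1 + v + 2 * v ^+ 2.
Proof.
move=> v2; have := expR_ge1Dx (- v); rewrite expRN => h.
have v1 : 0 < 1 - v by lra.
have e0 := expR_gt0 v.
have : expR v <= (1 - v)^-1.
  by rewrite -[leLHS]invrK lef_pV2// posrE invr_gt0.
move=> /le_trans; apply.
rewrite -div1r ler_pdivrMr//; have : 0 <= v ^+ 2 * (1 - 2 * v).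
  by rewrite mulr_ge0 ?sqr_ge0//; lra.
nra.
Qed.

Lemma expR_opp_le v : 0 <= v <= 1 -> expR (- v) <= 1 - v / 2.
Proof.
move=> /andP[v0 v1]; have := expR_ge1Dx v; rewrite expRN => h.
have : (expR v)^-1 <= (1 + v)^-1.
  by rewrite lef_pV2 ?posrE ?expR_gt0//; lra.
move=> /le_trans; apply; rewrite -div1r ler_pdivrMr; last by lra.
nra.
Qed.

(** The graph of a concave power lies below its tangents: this is Young's
    inequality for [(b / a) `^ s * 1]. *)
Lemma powR_le_tangent s a b : 0 < s < 1 -> 0 < a -> 0 <= b ->
  b `^ s <= a `^ s + s * a `^ (s - 1) * (b - a).
Proof.
move=> /andP[s0 s1] a0 b0.
have ba0 : 0 <= b / a by rewrite divr_ge0// ltW.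
have := @conjugate_powR R ((b / a) `^ s) 1 s^-1 (1 - s)^-1 (powR_ge0 _ _) ler01.
rewrite !invr_gt0 subr_gt0 !invrK addrC subrK => /(_ s0 s1 erefl).
rewrite mulr1 -powRrM mulfV ?gt_eqF// powRr1// powR1 mul1r => h.
rewrite -[in leLHS](divfK (lt0r_neq0 a0) b) powRM ?(ltW a0)//.
rewrite (le_trans (ler_wpM2r (powR_ge0 _ _) h))//.
rewrite powRB ?(gt_eqF s1) ?powRr1 ?(ltW a0)//; last first.
  by apply/implyP => _; rewrite gt_eqF.
rewrite le_eqVlt; apply/orP; left; apply/eqP.
by field; rewrite gt_eqF.
Qed.

(** Since [(1 + t) `^ p <= expR (p * t)], a power grows by at most its first
    order variation, up to a second order error. *)
Lemma powR_le_increment p u D : 0 < p -> 2 * p <= u -> 1 < u -> `|D| <= 1 ->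
  (u + D) `^ p <= u `^ p + p * u `^ (p - 1) * (D + 2 * p / u * D ^+ 2).
Proof.
move=> p0 pu u1; rewrite ler_norml => /andP[D1 D2].
have u0 : 0 < u by lra.
have uD : u + D = u * (1 + D / u) by field; rewrite gt_eqF.
have t0 : 0 < 1 + D / u.
  by rewrite -(pmulr_rgt0 _ u0) -uD; lra.
rewrite uD powRM ?(ltW u0) ?(ltW t0)//.
have le1 : (1 + D / u) `^ p <= expR (p * (D / u)).
  by rewrite /powR gt_eqF// ler_expR ler_pM2l// le_ln1Dx//; lra.
have v2 : p * (D / u) <= 2^-1 by rewrite mulrA ler_pdivrMr//; nra.
have le2 := le_trans le1 (expR_le_quadratic v2).
rewrite (le_trans (ler_wpM2l (powR_ge0 _ _) le2))//.
rewrite powRB ?powRr1 ?(ltW u0)//; last by apply/implyP => _; rewrite gt_eqF.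
rewrite le_eqVlt; apply/orP; left; apply/eqP.
by field; rewrite gt_eqF.
Qed.

(** The left-hand side is the derivative in [u] of [c * (tau + A * u `^ p) `^ s]
    when [s * p = 1]: the bound does not depend on [tau] and is small with [c]. *)
Lemma slope_le s p A c tau u : 0 < s < 1 -> s * p = 1 -> 0 < A -> 0 < c ->
  0 <= tau -> 0 < u ->
  c * A * u `^ (p - 1) * (tau + A * u `^ p) `^ (s - 1) <= c * A `^ s.
Proof.
move=> /andP[s0 s1] sp A0 c0 tau0 u0.
have Au0 : 0 < A * u `^ p by rewrite mulr_gt0// powR_gt0.
have le1 : (tau + A * u `^ p) `^ (s - 1) <= (A * u `^ p) `^ (s - 1).
  by apply: powR_antitone => //; lra.
have cu0 : 0 <= c * A * u `^ (p - 1) by rewrite !mulr_ge0 ?powR_ge0// ltW.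
rewrite (le_trans (ler_wpM2l cu0 le1))//.
rewrite powRM ?powR_ge0 ?(ltW A0)// -powRrM.
have -> : p * (s - 1) = 1 - p by rewrite mulrBr mulr1 mulrC sp.
rewrite (_ : _ * _ * _ * _ = c * (A * A `^ (s - 1)) *
  (u `^ (p - 1) * u `^ (1 - p))); last by ring.
rewrite mulr_powRB1 ?(ltW A0)// -powRD; last by rewrite (gt_eqF u0) implybT.
by rewrite (_ : p - 1 + (1 - p) = 0) ?powRr0 ?mulr1//; ring.
Qed.

(** The last factor shows that the second order term in [D] is at most [1 / 32] of
    the first order coefficient, small enough for the quadratic effect of the
    rejections to dominate it. *)
Lemma lyapunov_increment s p A c tau u D : 0 < s < 1 -> s * p = 1 ->
  0 < A -> 0 < c -> 512 * (c * A `^ s) <= 1 -> 0 < tau -> 128 * p <= u ->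
  `|D| <= 1 ->
  (let T := tau + A * u `^ p in
  expR (c * (tau + A * (u + D) `^ p) `^ s) <= expR (c * T `^ s) *
    (1 + c * A * u `^ (p - 1) * T `^ (s - 1) * (D + D ^+ 2 / 32)) : Prop).
Proof.
move=> /andP[s0 s1] sp A0 c0 cA tau0 pu D1 T.
have p0 : 0 < p by rewrite -(pmulr_rgt0 _ s0) sp.
have p1 : 1 < p by rewrite -sp gtr_pMl.
have u0 : 0 < u by lra.
have u1 : 1 < u by lra.
have u2 : 2 * p <= u by lra.
have K1 : 64 * (2 * p / u) <= 1 by rewrite mulrA ler_pdivrMr//; lra.
have T0 : 0 < T by rewrite addr_gt0// mulr_gt0// powR_gt0.
have T'0 : 0 <= tau + A * (u + D) `^ p.
  by rewrite addr_ge0 ?mulr_ge0 ?powR_ge0// ltW.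
set b := c * A * u `^ (p - 1) * T `^ (s - 1).
have b0 : 0 <= b by rewrite /b !mulr_ge0 ?powR_ge0// ltW.
have b1 : 512 * b <= 1.
  have : b <= c * A `^ s.
    by apply: slope_le => //; [rewrite s0|exact: ltW].
  by lra.
set K := 2 * p / u.
have K0 : 0 <= K by rewrite /K divr_ge0 ?mulr_ge0// ltW.
rewrite -/K in K1.
have le1 : c * (tau + A * (u + D) `^ p) `^ s <=
    c * T `^ s + b * (D + K * D ^+ 2).
  have sT : 0 <= s * T `^ (s - 1) by rewrite mulr_ge0 ?powR_ge0// ltW.
  have h1 := @powR_le_tangent s T _ (introT andP (conj s0 s1)) T0 T'0.
  have h2 : A * (u + D) `^ p <=
      A * (u `^ p + p * u `^ (p - 1) * (D + K * D ^+ 2)).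
    by apply: ler_wpM2l; [exact: ltW|exact: powR_le_increment].
  have h3 : tau + A * (u + D) `^ p - T <=
      A * (p * u `^ (p - 1) * (D + K * D ^+ 2)).
    by rewrite /T opprD addrACA subrr add0r lerBlDl -mulrDr.
  have h4 := ler_wpM2l sT h3.
  have h5 := ler_wpM2l (ltW c0) (le_trans h1 (lerD (lexx _) h4)).
  apply: (le_trans h5); rewrite le_eqVlt; apply/orP; left; apply/eqP.
  rewrite /b mulrDr; congr (_ + _).
  transitivity ((s * p) *
    (c * A * u `^ (p - 1) * T `^ (s - 1) * (D + K * D ^+ 2))); first by ring.
  by rewrite sp mul1r.
rewrite -ler_expR in le1; rewrite (le_trans le1)// expRD ler_wpM2l ?expR_ge0//.
have DD : D ^+ 2 = `|D| ^+ 2 by rewrite real_normK ?num_real.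
have DN : D <= `|D| by exact: ler_norm.
have DN' : - `|D| <= D by rewrite lerNl ler_normr lexx orbT.
have D0 : 0 <= `|D| by [].
set a := `|D| in DD DN DN' D0 D1 *.
have aa : a ^+ 2 <= a by rewrite expr2 ler_piMr.
have D20 : 0 <= D ^+ 2 by exact: sqr_ge0.
have KD0 : 0 <= K * D ^+ 2 by rewrite mulr_ge0.
have KD : K * D ^+ 2 <= 64^-1 * D ^+ 2 by rewrite ler_wpM2r//; lra.
set E := D + K * D ^+ 2.
have Ea : `|E| <= 2 * a by rewrite ler_norml /E; lra.
have E3 : E ^+ 2 <= 4 * D ^+ 2.
  rewrite -[E ^+ 2]real_normK ?num_real// DD (_ : 4 * a ^+ 2 = (2 * a) ^+ 2).
    by rewrite lerXn2r// nnegrE// mulr_ge0.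
  by ring.
have v2 : b * E <= 2^-1.
  rewrite (le_trans (ler_norm _))// normrM (ger0_norm b0).
  have b2 : b <= 4^-1 by clear -b1; lra.
  have E2 : `|E| <= 2 by clear -Ea D1; lra.
  by apply: (le_trans (ler_pM b0 (normr_ge0 _) b2 E2)); clear; lra.
rewrite (le_trans (expR_le_quadratic v2))// -addrA lerD2l exprMn.
have h1 : b ^+ 2 * E ^+ 2 <= b * (512^-1 * (4 * D ^+ 2)).
  by rewrite expr2 -mulrA ler_wpM2l// ler_pM ?sqr_ge0//; lra.
have h2 : b * (K * D ^+ 2) <= b * (64^-1 * D ^+ 2) by rewrite ler_wpM2l.
have h3 : 0 <= b * D ^+ 2 by rewrite mulr_ge0.
have e1 : b * (512^-1 * (4 * D ^+ 2)) = 512^-1 * 4 * (b * D ^+ 2) by ring.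
have e2 : b * (64^-1 * D ^+ 2) = 64^-1 * (b * D ^+ 2) by ring.
have e3 : b * (D + D ^+ 2 / 32) = b * D + 32^-1 * (b * D ^+ 2) by ring.
have e0 : b * E = b * D + b * (K * D ^+ 2) by exact: mulrDr.
rewrite e0 e3; rewrite e1 in h1; rewrite e2 in h2; clear -h1 h2 h3; lra.
Qed.

End real_inequalities.

Section exponential_inequalities.
Context {R : realType}.
Implicit Types (a b c e r s p u v x A T tau : R).

(** Lowering the time by one costs at most a proportion [2 * c * T `^ (s - 1)]. *)
Lemma time_step_le s c T : 0 < s < 1 -> 0 < c -> 2 <= T ->
  expR (c * T `^ s) * (1 - 2 * c * T `^ (s - 1)) <= expR (c * (T - 1) `^ s).
Proof.
move=> /andP[s0 s1] c0 T2.
have T0 : 0 < T by lra.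
have T10 : 0 < T - 1 by lra.
have h1 := @powR_le_tangent _ s (T - 1) T (introT andP (conj s0 s1)) T10 (ltW T0).
have h2 : (T - 1) `^ (s - 1) <= 2 * T `^ (s - 1).
  have h : (T - 1) `^ (s - 1) <= (T / 2) `^ (s - 1) by apply: powR_antitone; lra.
  rewrite (le_trans h)// powRM ?(ltW T0)// mulrC ler_wpM2r ?powR_ge0//.
  rewrite -powR_inv1// -powRrM.
  have -> : -1 * (s - 1) = 1 - s by ring.
  by rewrite -[leRHS]powRr1//; apply: ler_powR; lra.
have h3 : T `^ s - (T - 1) `^ s <= 2 * T `^ (s - 1).
  have : s * (T - 1) `^ (s - 1) <= 1 * (2 * T `^ (s - 1)).
    by rewrite ler_pM ?powR_ge0// ltW.
  rewrite mul1r; move: h1.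
  have -> : T - (T - 1) = 1 by ring.
  by rewrite mulr1; lra.
rewrite [in leRHS](_ : c * (T - 1) `^ s =
  c * T `^ s + - (c * (T `^ s - (T - 1) `^ s))); last by ring.
rewrite expRD ler_wpM2l ?expR_ge0//.
apply: le_trans (expR_ge1Dx _).
by rewrite lerD2l lerN2 (mulrC 2 c) -mulrA ler_pM2l.
Qed.

(** The logarithmic derivative [(s - 1) / tau + c * s * tau `^ (s - 1)] of the
    function below is nonnegative as soon as [1 - s <= c * s * tau `^ s]. *)
Lemma powR_expR_monotone s c a b : 0 < s < 1 -> 0 < a -> a <= b ->
  1 - s <= c * s * a `^ s ->
  a `^ (s - 1) * expR (c * a `^ s) <= b `^ (s - 1) * expR (c * b `^ s).
Proof.
move=> /andP[s0 s1] a0 ab h.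
have b0 : 0 < b by exact: lt_le_trans ab.
set v := a `^ s; set w := b `^ s.
have v0 : 0 < v by exact: powR_gt0.
have w0 : 0 < w by exact: powR_gt0.
have vw : v <= w by apply: powR_monotone; lra.
have l1 : ln w - ln v <= w / v - 1.
  rewrite -ln_div ?posrE// -[X in ln X](subrK 1) addrC.
  by apply: le_ln1Dx; have := divr_gt0 w0 v0; lra.
have e1 : ln w - ln v = s * (ln b - ln a) by rewrite !ln_powR mulrBr.
have l2 : (1 - s) * (ln b - ln a) <= c * (w - v).
  have -> : (1 - s) * (ln b - ln a) = (1 - s) / s * (ln w - ln v).
    by rewrite e1; field; rewrite gt_eqF.
  have k0 : 0 <= (1 - s) / s by rewrite divr_ge0//; lra.
  rewrite (le_trans (ler_wpM2l k0 l1))//.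
  have -> : (1 - s) / s * (w / v - 1) = ((1 - s) / (s * v)) * (w - v).
    by field; rewrite !gt_eqF.
  rewrite ler_wpM2r ?subr_ge0// ler_pdivrMr ?mulr_gt0//.
  by rewrite mulrA.
rewrite {1 2}/powR !gt_eqF// -!expRD ler_expR.
move: l2; rewrite mulrBr mulrBr; lra.
Qed.

(** A move raising [U] by [D] is rejected with probability about [D]: this is
    where the drift comes from. *)
Lemma acceptance_le (D : R) : `|D| <= 1 ->
  (D + D ^+ 2 / 32) * Num.min (expR (- D)) 1 <=
  D - (Num.max 0 D) ^+ 2 / 2 + D ^+ 2 / 32.
Proof.
move=> D1; have [D0|D0] := leP D 0.
- rewrite min_r; last by rewrite -expR0 ler_expR; lra.
  by rewrite expr0n/= mulr1; lra.
- move: D1; rewrite gtr0_norm// => D1.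
  rewrite min_l; last by rewrite -expR0 ler_expR; lra.
  have h := expR_opp_le (introT andP (conj (ltW D0) D1)).
  have k : 0 <= D + D ^+ 2 / 32 by have := sqr_ge0 D; lra.
  apply: (le_trans (ler_wpM2l k h)).
  have : 0 <= D ^+ 3 by rewrite exprn_ge0// ltW.
  rewrite !exprS expr0; nra.
Qed.

(** In opposite directions the first order terms cancel, and what remains is
    the rejection of the upward move, of order [l ^+ 2]. *)
Lemma opposite_moves_le (l e1 e2 H : R) : `|e1| <= H -> `|e2| <= H -> H <= 1 ->
  (l + e1 - (Num.max 0 (l + e1)) ^+ 2 / 2 + (l + e1) ^+ 2 / 32) +
  (- l + e2 - (Num.max 0 (- l + e2)) ^+ 2 / 2 + (- l + e2) ^+ 2 / 32) <=
  3 * H - l ^+ 2 / 8.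
Proof.
wlog l0 : l e1 e2 / 0 <= l.
  move=> hw h1 h2 H1; have [l0|l0] := leP 0 l; first exact: hw.
  have := hw (- l) e2 e1; rewrite oppr_ge0 sqrrN opprK addrC.
  by apply => //; exact: ltW.
move=> h1 h2 H1.
have H0 : 0 <= H by exact: le_trans h1.
move: h1 h2; rewrite !ler_norml => /andP[h1 h1'] /andP[h2 h2'].
have q1 : e1 ^+ 2 <= H ^+ 2 by nra.
have q2 : e2 ^+ 2 <= H ^+ 2 by nra.
have HH : H ^+ 2 <= H by nra.
have m2 : 0 <= (Num.max 0 (- l + e2)) ^+ 2 by exact: sqr_ge0.
have m1 : l ^+ 2 / 2 - H ^+ 2 <= (Num.max 0 (l + e1)) ^+ 2.
  have [le0|le0] := leP (l + e1) 0.
    have : l ^+ 2 <= H ^+ 2 by nra.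
    by rewrite expr0n/=; have := sqr_ge0 l; lra.
  have : 0 <= (l / 2 + e1) ^+ 2 by exact: sqr_ge0.
  have : 0 <= (l / 2) ^+ 2 by exact: sqr_ge0.
  nra.
have s1 : (l + e1) ^+ 2 <= 2 * l ^+ 2 + 2 * e1 ^+ 2.
  by have := sqr_ge0 (l - e1); nra.
have s2 : (- l + e2) ^+ 2 <= 2 * l ^+ 2 + 2 * e2 ^+ 2.
  by have := sqr_ge0 (l + e2); nra.
move: m1 m2 s1 s2 q1 q2 HH h1 h1' h2 h2'; clear; lra.
Qed.

End exponential_inequalities.

(** * Lebesgue measure on row vectors *)

Section lebesgue_invariance.
Context {R : realType}.
Local Notation mu := (@lebesgue_measure R).

Lemma lebesgue_measure_translate (a : R) (A : set R) : measurable A ->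
  mu ((fun x => a + x) @^-1` A) = mu A.
Proof.
have mf : measurable_fun setT ((fun x => a + x) : measurableTypeR R -> measurableTypeR R).
  by apply: measurable_funD.
move=> mA; apply/esym.
pose f : {mfun measurableTypeR R >-> measurableTypeR R} :=
  HB.pack (fun x : R => a + x) (isMeasurableFun.Build _ _ _ _ _ mf).
apply: (@lebesgue_measure_unique R (pushforward mu f)) => //= _ [[u v]] _ <-.
rewrite /pushforward/=.
have -> : (fun x => a + x) @^-1` `]u, v] = `](u - a), (v - a)]%classic.
  by apply/seteqP; split => x /=; rewrite !in_itv/=; lra.
rewrite !lebesgue_measure_itv/= !lte_fin ltrD2r.
by case: ifPn => // _; rewrite -!EFinB; congr EFin; ring.
Qed.

Definition coordinatewise n (phi : 'I_n -> R -> R) (v : 'rV[R]_n) : 'rV[R]_n :=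
  \row_i phi i (v 0 i).

Lemma measurable_coordinatewise n (phi : 'I_n -> R -> R) :
  (forall i, measurable_fun setT (phi i)) ->
  measurable_fun setT (coordinatewise phi).
Proof.
move=> mphi; apply: measurable_fun_rV => i.
under eq_fun do rewrite mxE.
exact: measurableT_comp (measurable_coord_rV i).
Qed.

(** By uniqueness of product measures, one coordinate at a time. *)
Lemma lebesgue_rV_coordinatewise n (phi : 'I_n -> R -> R) (A : set 'rV[R]_n) :
  (forall i, measurable_fun setT (phi i)) ->
  (forall i B, measurable B -> mu (phi i @^-1` B) = mu B) ->
  measurable A ->
  lebesgue_rV R n (coordinatewise phi @^-1` A) = lebesgue_rV R n A.
Proof.
elim: n phi A => [|n ih] phi A mphi phiE mA.
  congr (lebesgue_rV R 0 _); apply/seteqP; split => v /=;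
    by rewrite (_ : coordinatewise phi v = v)//; apply/rowP => -[].
pose psi (i : 'I_n) := phi (lift 0 i).
pose g (p : measurableTypeR R * 'rV[R]_n) := (phi 0 p.1 : measurableTypeR R, coordinatewise psi p.2).
have mg : measurable_fun setT g.
  apply/measurable_fun_pairP; split => /=.
    exact: measurableT_comp (mphi 0) measurable_fst.
  apply: measurableT_comp measurable_snd.
  by apply: measurable_coordinatewise => i; exact: mphi.
pose gm : {mfun _ >-> _} := HB.pack g (isMeasurableFun.Build _ _ _ _ _ mg).
rewrite /= /lebesgue_cons /pushforward.
have -> : @cons_rV R n @^-1` (coordinatewise phi @^-1` A) = g @^-1` (@cons_rV R n @^-1` A).
  have E p : coordinatewise phi (@cons_rV R n p) = @cons_rV R n (g p).
    apply/rowP => i; rewrite mxE; case: (unliftP 0 i) => [j ->|->].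
      by rewrite !cons_rVS mxE.
    by rewrite !cons_rV0.
  by apply/seteqP; split => p /=; rewrite E.
have mB : measurable (@cons_rV R n @^-1` A : set (measurableTypeR R * 'rV[R]_n)).
  by rewrite -[X in measurable X]setTI; exact: measurable_cons_rV.
rewrite [RHS](@product_measure_unique _ _ _ _ _ _ _
  (pushforward (mu \x lebesgue_rV R n)%E gm))//.
move=> B C mB' mC; rewrite /pushforward/=.
transitivity ((mu \x lebesgue_rV R n)%E
  ((phi 0 @^-1` B) `*` (coordinatewise psi @^-1` C))); first by [].
rewrite product_measure1E/=.
- by rewrite phiE// ih// => i *; [exact: mphi|exact: phiE].
- by rewrite -[X in measurable X]setTI; exact: mphi.
- rewrite -[X in measurable X]setTI.
  by apply: measurable_coordinatewise => // i; exact: mphi.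
Qed.

Lemma lebesgue_rV_translate n (x : 'rV[R]_n) (A : set 'rV[R]_n) : measurable A ->
  lebesgue_rV R n ((fun y => x + y) @^-1` A) = lebesgue_rV R n A.
Proof.
move=> mA; pose phi i (r : R) := x 0 i + r.
have mphi i : measurable_fun setT (phi i) by apply: measurable_funD.
rewrite -(lebesgue_rV_coordinatewise mphi _ mA); last first.
  by move=> i B; exact: lebesgue_measure_translate.
congr (lebesgue_rV R n _); apply/seteqP; split => y /=;
  by rewrite (_ : coordinatewise phi y = x + y)//; apply/rowP => i; rewrite !mxE.
Qed.

Lemma lebesgue_rV_opp n (A : set 'rV[R]_n) : measurable A ->
  lebesgue_rV R n (-%R @^-1` A) = lebesgue_rV R n A.
Proof.
move=> mA; pose phi (i : 'I_n) (r : R) := - r.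
have mphi i : measurable_fun setT (phi i) by exact: measurable_funN.
rewrite -(lebesgue_rV_coordinatewise mphi _ mA); last first.
  by move=> i B; exact: lebesgue_measureN.
congr (lebesgue_rV R n _); apply/seteqP; split => y /=;
  by rewrite (_ : coordinatewise phi y = - y)//; apply/rowP => i; rewrite !mxE.
Qed.

End lebesgue_invariance.

Section lebesgue_balls.
Context {R : realType} {n : nat}.
Implicit Types x y z : 'rV[R]_n.

Lemma norm_coord_le x i : `|x 0 i| <= `|x|.
Proof.
rewrite [leRHS]/Num.norm/= mx_normrE.
by apply/bigmax_geP; right; exists (0, i).
Qed.

Lemma norm_le_coord x (e : R) : 0 <= e -> (forall i, `|x 0 i| <= e) ->
  `|x| <= e.
Proof.
move=> e0 h; rewrite [leLHS]/Num.norm/= mx_normrE; apply/bigmax_leP; split => //.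
by move=> [i j] _ /=; rewrite (ord1 i).
Qed.

Lemma lebesgue_box_gt0 (A : 'I_n -> set R) : (forall i, measurable (A i)) ->
  (forall i, (0 < lebesgue_measure (A i))%E) ->
  (0 < lebesgue_rV R n [set v : 'rV[R]_n | forall i, A i (v 0%R i)])%E.
Proof.
move=> mA A0; rewrite lebesgue_rV_box//.
by elim/big_ind : _ => [|u v|i _]; [exact: lte01|exact: mule_gt0|exact: A0].
Qed.

Lemma ball_rVE x (e : R) : 0 < e -> ball x e =
  [set v | forall i, `]x 0 i - e, x 0 i + e[%classic (v 0 i)].
Proof.
move=> e0; apply/seteqP; split => v /=.
  move=> [_ h] i; have := h 0 i.
  by rewrite /ball/= in_itv/= distrC ltr_distl => /andP[-> ->].
move=> h; split => // i j; rewrite (ord1 i).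
by have := h j; rewrite /ball/= in_itv/= distrC ltr_distl.
Qed.

Lemma measurable_ball_rV x (e : R) : measurable (ball x e).
Proof. by apply: open_measurable_rV; exact: ball_open. Qed.

(** The centre enters through translation invariance only, so that the bound is
    uniform in it. *)
Lemma lebesgue_ballE x (e : R) : 0 < e ->
  lebesgue_rV R n (ball x e) = lebesgue_rV R n (ball 0 e).
Proof.
move=> e0; rewrite -(lebesgue_rV_translate x); last exact: measurable_ball_rV.
congr (lebesgue_rV R n _); apply/seteqP; split => v /=;
  by rewrite -!ball_normE/= opprD addNKr sub0r.
Qed.

Lemma lebesgue_ball_gt0 x (e : R) : 0 < e -> (0 < lebesgue_rV R n (ball x e))%E.
Proof.
move=> e0; rewrite ball_rVE//.
apply: (lebesgue_box_gt0 (A := fun i => `]x 0 i - e, x 0 i + e[%classic)) => // i.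
by rewrite lebesgue_measure_itv/= lte_fin ifT -?EFinB ?lte_fin; lra.
Qed.

(** The balls of a given radius with rational centres are countably many and
    cover the space. *)
Lemma lebesgue_gt0_ball (B : set 'rV[R]_n) (e : R) : 0 < e -> measurable B ->
  (0 < lebesgue_rV R n B)%E ->
  exists z, (0 < lebesgue_rV R n (B `&` ball z e))%E.
Proof.
move=> e0 mB B0; apply: contrapT => /forallNP h.
have h0 z : lebesgue_rV R n (B `&` ball z e) = 0%E.
  by apply/eqP; rewrite eq_le measure_ge0 andbT leNgt; exact/negP/h.
pose c (r : 'rV[rat]_n) : 'rV[R]_n := \row_i ratr (r 0 i).
have BE : B `<=` \bigcup_r (B `&` ball (c r) e).
  move=> v Bv.
  have Hr i : exists r : rat, `|v 0 i - ratr r| < e / 2.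
    have : v 0 i - e / 2 < v 0 i + e / 2 by lra.
    move=> /rat_in_itvoo[r /[!in_itv]/= rI].
    by exists r; rewrite distrC ltr_distl.
  have {Hr}[r Hr] := choice Hr.
  exists (\row_i r i) => //; split => //.
  rewrite -ball_normE/=; apply: (@le_lt_trans _ _ (e / 2)); last by lra.
  apply: norm_le_coord => [|i]; first by lra.
  by rewrite !mxE distrC ltW// Hr.
move: B0; rewrite ltNge => /negP; apply.
pose F k : set 'rV[R]_n :=
  if @choice.unpickle 'rV[rat]_n k is Some r then B `&` ball (c r) e else set0.
have FN : (lebesgue_rV R n).-negligible (\bigcup_k F k).
  apply: negligible_bigcup => k; rewrite /F; case: choice.unpickle => [r|].
    exists (B `&` ball (c r) e); split => //; last exact: h0.
    by apply: measurableI => //; exact: measurable_ball_rV.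
  exact: negligible_set0.
have BF : B `<=` \bigcup_k F k.
  by move=> v /BE[r _ vr]; exists (choice.pickle r) => //; rewrite /F choice.pickleK.
by rewrite (measure_negligible mB (negligibleS BF FN)).
Qed.

End lebesgue_balls.

(** * Integrals as functionals *)

Section integral_functional.
Context d (T : measurableType d) (R : realType).
Variables (mu : {measure set T -> \bar R}) (L : (T -> \bar R) -> \bar R).
Local Open Scope ereal_scope.
Hypothesis L_indic : forall A, measurable A -> L (fun x => (\1_A x)%:E) = mu A.
Hypothesis LD : forall f g, measurable_fun setT f -> measurable_fun setT g ->
  (forall x, 0 <= f x) -> (forall x, 0 <= g x) ->
  L (fun x => f x + g x) = L f + L g.
Hypothesis LZ : forall (k : R) f, measurable_fun setT f ->
  (forall x, 0 <= f x) -> (0 <= k)%R -> L (fun x => k%:E * f x) = k%:E * L f.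
Hypothesis Llim : forall g : nat -> T -> \bar R,
  (forall k, measurable_fun setT (g k)) -> (forall k x, 0 <= g k x) ->
  (forall x, nondecreasing_seq (g ^~ x)) ->
  L (fun x => limn (g ^~ x)) = limn (fun k => L (g k)).

Import HBNNSimple.

Let L_nnsfun (f : {nnsfun T >-> R}) :
  L (fun x => (f x)%:E) = \int[mu]_x (f x)%:E.
Proof.
have mpre r : measurable (f @^-1` [set r]).
  by rewrite -[X in measurable X]setTI; exact: measurable_funP.
have fE : (fun x => (f x)%:E) = (fun x =>
    \sum_(r <- fset_set (range f)) (r * \1_(f @^-1` [set r]) x)%:E).
  by apply/funext => x; rewrite fimfunE fsbig_finite// sumEFin.
have LS (s : seq R) : (forall r, r \in s -> (0 <= r)%R) ->
    L (fun x => \sum_(r <- s) (r * \1_(f @^-1` [set r]) x)%:E) =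
    \sum_(r <- s) r%:E * mu (f @^-1` [set r]).
  elim: s => [_|r s ih s0].
    under eq_fun do rewrite big_nil; rewrite big_nil.
    transitivity (L (fun x => (\1_set0 x)%:E)).
      by congr L; apply/funext => x; rewrite indic0.
    by rewrite L_indic// measure0.
  have r0 : (0 <= r)%R by apply: s0; rewrite inE eqxx.
  have s0' t : t \in s -> (0 <= t)%R by move=> ts; apply: s0; rewrite inE ts orbT.
  have mi t : measurable_fun setT (fun x : T => (\1_(f @^-1` [set t]) x)%:E : \bar R).
    by apply/measurable_EFinP; exact: measurable_indic.
  have mri t : measurable_fun setT (fun x : T => (t * \1_(f @^-1` [set t]) x)%:E : \bar R).
    by under eq_fun do rewrite EFinM; exact: measurable_funeM.
  under eq_fun do rewrite big_cons.
  rewrite big_cons LD//.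
  - rewrite -ih//; congr (_ + _).
    under eq_fun do rewrite EFinM.
    by rewrite LZ ?L_indic// => x; rewrite lee_fin.
  - by apply: emeasurable_sum => t; exact: mri.
  - by move=> x; rewrite lee_fin mulr_ge0.
  - move=> x; rewrite big_seq; apply: sume_ge0 => t ts.
    by rewrite lee_fin mulr_ge0// s0'.
rewrite fE LS; last first.
  move=> r; rewrite in_fset_set// inE => -[x _ <-].
  exact: fun_ge0.
rewrite -fE integral_nnsfun//.
have -> : f \_ setT = f :> (T -> R) by apply/funext => x; rewrite patchT ?inE.
by rewrite sintegralE fsbig_finite.
Qed.

(** By approximation with simple functions. It serves to integrate against
    measures that are only known through their values on sets: transition kernels
    and the laws given by the Markov property. *)
Lemma ge0_integral_functionalE f : measurable_fun setT f ->
  (forall x, 0 <= f x) -> L f = \int[mu]_x f x.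
Proof.
move=> mf f0; pose f_ := nnsfun_approx measurableT mf.
have mf_ k : measurable_fun setT (fun x => (f_ k x)%:E).
  by apply/measurable_EFinP.
have f_0 k x : 0 <= (f_ k x)%:E by rewrite lee_fin.
have ndf x : nondecreasing_seq (fun k => (f_ k x)%:E).
  by move=> a b ab; rewrite lee_fin; exact/lefP/nd_nnsfun_approx.
have fE : f = (fun x => limn (fun k => (f_ k x)%:E)).
  apply/funext => x; apply/esym/cvg_lim => //.
  exact: (cvg_nnsfun_approx measurableT mf (fun x _ => f0 x)).
rewrite [in LHS]fE (Llim (g := fun k x => (f_ k x)%:E))//.
rewrite [in RHS]fE monotone_convergence//.
by congr (limn _); apply/funext => k; exact: L_nnsfun.
Qed.

End integral_functional.

(** * Chains killed in a set *)

Section killed_chain.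
Context {R : realType} {d : measure_display} {T : measurableType d}.
Variables (P : R.-pker T ~> T) (B : set T).
Hypothesis mB : measurable B.
Local Open Scope ereal_scope.
Implicit Types g : T -> \bar R.

(** One step of the chain killed when it enters [B]. *)
Definition killed g (x : T) : \bar R := \int[P x]_(y in ~` B) g y.

Lemma killed_ge0 g : (forall x, 0 <= g x) -> forall x, 0 <= killed g x.
Proof. by move=> g0 x; exact: integral_ge0. Qed.

Lemma killedE g x : killed g x = \int[P x]_y (g \_ (~` B)) y.
Proof. by rewrite /killed integral_mkcond. Qed.

Lemma measurable_patchC g : measurable_fun setT g ->
  measurable_fun setT (g \_ (~` B)).
Proof.
move=> mg; apply/(measurable_restrictT _ _).1 => //; first exact: measurableC.
exact: measurable_funS mg.
Qed.

Lemma measurable_killed g : measurable_fun setT g -> (forall x, 0 <= g x) ->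
  measurable_fun setT (killed g).
Proof.
move=> mg g0; rewrite (funext (killedE g)).
apply: measurable_fun_integral_kernel.
- by move=> U mU; exact: measurable_kernel.
- by move=> z; rewrite /patch; case: ifPn.
- exact: measurable_patchC.
Qed.

Lemma le_killed g1 g2 x : measurable_fun setT g1 -> measurable_fun setT g2 ->
  (forall x, 0 <= g1 x) -> (forall x, g1 x <= g2 x) ->
  killed g1 x <= killed g2 x.
Proof.
move=> m1 m2 g0 g12; apply: ge0_le_integral => //; try exact: measurableC.
- exact: measurable_funS m1.
- exact: measurable_funS m2.
Qed.

Lemma killedD g1 g2 x : measurable_fun setT g1 -> measurable_fun setT g2 ->
  (forall x, 0 <= g1 x) -> (forall x, 0 <= g2 x) ->
  killed (fun x => g1 x + g2 x) x = killed g1 x + killed g2 x.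
Proof.
move=> m1 m2 g0 h0; rewrite /killed ge0_integralD//; first exact: measurableC.
- exact: measurable_funS m1.
- exact: measurable_funS m2.
Qed.

Lemma killedZ (k : R) g x : measurable_fun setT g -> (0 <= k)%R ->
  (forall x, 0 <= g x) -> killed (fun x => k%:E * g x) x = k%:E * killed g x.
Proof.
move=> m1 k0 g0; rewrite /killed ge0_integralZl//; first exact: measurableC.
exact: measurable_funS m1.
Qed.

Lemma killed_le_integral g x : measurable_fun setT g -> (forall x, 0 <= g x) ->
  killed g x <= \int[P x]_y g y.
Proof.
by move=> mg g0; apply: ge0_subset_integral => //; exact: measurableC.
Qed.

Lemma killed1_le1 x : killed (cst 1) x <= 1.
Proof.
rewrite /killed integral_cst ?mul1e; last exact: measurableC.
by rewrite -(@prob_kernel _ _ _ _ _ P x) le_measure// inE//; exact: measurableC.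
Qed.

Section chain.
Context (lambda : probability T R) {dO : measure_display}.
Context {Omega : measurableType dO}.
Variables (Pr : probability Omega R) (Phi : nat -> Omega -> T).
Hypothesis chain : markov_chain P lambda Pr Phi.

Let mPhi k : measurable_fun setT (Phi k).
Proof. by case: chain. Qed.

(** Both sides are integrals of [g] for the law of [Phi k.+1] on [F]. *)
Lemma markov_property_integral k F g : measurable F ->
  g_sigma_preimage (fun i : 'I_k.+1 => Phi i) F ->
  measurable_fun setT g -> (forall x, 0 <= g x) ->
  \int[Pr]_(w in F) g (Phi k.+1 w) =
  \int[Pr]_(w in F) \int[P (Phi k w)]_y g y.
Proof.
move=> mF pastF mg g0.
pose PhiS : {mfun Omega >-> T} :=
  HB.pack (Phi k.+1) (isMeasurableFun.Build _ _ _ _ _ (mPhi k.+1)).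
pose mu := pushforward (mrestr Pr mF) PhiS.
have mP (h : T -> \bar R) : measurable_fun setT h -> (forall x, 0 <= h x) ->
    measurable_fun F (fun w => \int[P (Phi k w)]_y h y).
  move=> mh h0; apply: measurable_funTS.
  apply: (@measurableT_comp _ _ _ _ _ _ (fun x => \int[P x]_y h y)) => //.
  apply: measurable_fun_integral_kernel => //.
  by move=> U mU; exact: measurable_kernel.
have mS (h : T -> \bar R) : measurable_fun setT h -> measurable_fun F (fun w => h (Phi k.+1 w)).
  by move=> mh; apply: measurable_funTS; exact: measurableT_comp mh (mPhi k.+1).
have nd (f : nat -> T -> \bar R) x : (forall k, measurable_fun setT (f k)) ->
    (forall k y, 0 <= f k y) -> (forall y, nondecreasing_seq (f ^~ y)) ->
    nondecreasing_seq (fun j => \int[P x]_y f j y).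
  move=> mf f0 ndf a b ab; apply: ge0_le_integral => // y _; exact: ndf.
transitivity (\int[mu]_x g x).
  apply: (@ge0_integral_functionalE _ _ _ mu
    (fun h => \int[Pr]_(w in F) h (Phi k.+1 w))) => //.
  - move=> A mA; have mA' : measurable (Phi k.+1 @^-1` A).
      by rewrite -[X in measurable X]setTI; exact: mPhi.
    by rewrite (@integral_indic _ _ _ Pr F mF (Phi k.+1 @^-1` A)).
  - move=> h1 h2 m1 m2 h10 h20.
    by rewrite ge0_integralD//; exact: mS.
  - by move=> r h m1 h10 r0; rewrite ge0_integralZl//; exact: mS.
  - move=> f mf f0 ndf; rewrite -monotone_convergence// => j; exact: mS.
apply/esym; apply: (@ge0_integral_functionalE _ _ _ mu
  (fun h => \int[Pr]_(w in F) \int[P (Phi k w)]_y h y)) => //.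
- move=> A mA; under eq_integral do rewrite integral_indic// setIT.
  by case: chain => _ _ <-//; rewrite /mu /pushforward /= /mrestr setIC.
- move=> h1 h2 m1 m2 h10 h20.
  rewrite -ge0_integralD//; last 4 first.
  + by move=> w _; exact: integral_ge0.
  + exact: mP.
  + by move=> w _; exact: integral_ge0.
  + exact: mP.
  by apply: eq_integral => w _; rewrite ge0_integralD.
- move=> r h m1 h10 r0.
  rewrite -ge0_integralZl//; last 2 first.
  + exact: mP.
  + by move=> w _; exact: integral_ge0.
  by apply: eq_integral => w _; rewrite ge0_integralZl.
- move=> f mf f0 ndf; rewrite -monotone_convergence//; last 3 first.
  + by move=> j; exact: mP.
  + by move=> j w _; exact: integral_ge0.
  + by move=> w _; exact: nd.
  by apply: eq_integral => w _; rewrite monotone_convergence.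
Qed.

Definition not_yet k : set Omega := [set w | forall j, (0 < j <= k)%N -> ~ B (Phi j w)].

Lemma not_yet0 : not_yet 0 = setT.
Proof. by apply/seteqP; split => // w _ j; case: j. Qed.

Lemma not_yetS k : not_yet k.+1 = not_yet k `&` (Phi k.+1 @^-1` ~` B).
Proof.
apply/seteqP; split => [w h|w [h1 h2] j].
  by split=> [j /andP[j0 jk]|]; apply: h; rewrite ?j0 ?leqnn// leqW.
move=> /andP[j0]; rewrite leq_eqVlt ltnS => /predU1P[->//|jk].
by apply: h1; rewrite j0.
Qed.

(** The event is determined by the first [k] steps, as the Markov property
    requires. *)
Lemma not_yet_past k : g_sigma_preimage (fun i : 'I_k.+1 => Phi i) (not_yet k).
Proof.
pose U j : set Omega := if (0 < j <= k)%N then Phi j @^-1` B else set0.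
have -> : not_yet k = ~` \bigcup_j U j.
  apply/seteqP; split => [w h [j _]|w h j jk Bj].
    by rewrite /U; case: ifPn => // jk; exact: h.
  by apply: h; exists j => //; rewrite /U jk.
apply: sigma_algebraC; apply: sigma_algebra_bigcup => j.
rewrite /U; case: ifPn => [/andP[_ jk]|_]; last exact: sigma_algebra0.
apply: sub_sigma_algebra; rewrite -bigcup_mkord_ord; exists j => //=.
by exists B => //; rewrite setTI inordK.
Qed.

Lemma measurable_not_yet k : measurable (not_yet k).
Proof.
elim: k => [|k ih]; first by rewrite not_yet0.
rewrite not_yetS; apply: measurableI => //.
by rewrite -[X in measurable X]setTI; apply: mPhi => //; exact: measurableC.
Qed.

Lemma lt_return_time k w : (k%:R%:E < return_time Phi B w :> \bar R) = (w \in not_yet k).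
Proof.
apply/idP/idP => [h|/set_mem h].
  apply/mem_set => j /andP[j0 jk] Bj; move: h; apply/negP; rewrite -leNgt.
  apply: (@le_trans _ _ (j%:R%:E : \bar R)); last by rewrite lee_fin ler_nat.
  by apply: ereal_inf_lbound; exists j.
apply: (@lt_le_trans _ _ (k.+1%:R%:E : \bar R)); first by rewrite lte_fin ltr_nat.
apply: le_ereal_inf_tmp => _ [j [j0 Bj] <-].
rewrite lee_fin ler_nat ltnNge; apply/negP => jk.
by apply: (h j); rewrite ?j0.
Qed.

Lemma integral_not_yetS k g : measurable_fun setT g -> (forall x, 0 <= g x) ->
  \int[Pr]_(w in not_yet k.+1) g (Phi k.+1 w) =
  \int[Pr]_(w in not_yet k) killed g (Phi k w).
Proof.
move=> mg g0; under [RHS]eq_integral do rewrite killedE.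
rewrite -markov_property_integral; last 4 first.
- exact: measurable_not_yet.
- exact: not_yet_past.
- exact: measurable_patchC.
- by move=> x; rewrite /patch; case: ifPn.
rewrite not_yetS integral_mkcondr; apply: eq_integral => w _.
by rewrite /patch.
Qed.

(** Maximum principle: a supersolution [Z n k], where [n] is the remaining time and
    [k] the current one, dominates the expected sum of its source term [gain]. *)
Lemma killed_comparison (gain : nat -> T -> \bar R)
    (Z : nat -> nat -> T -> \bar R) :
  (forall k, measurable_fun setT (gain k)) -> (forall k x, 0 <= gain k x) ->
  (forall n k, measurable_fun setT (Z n k)) -> (forall n k x, 0 <= Z n k x) ->
  (forall n k x, gain k x + killed (Z n k.+1) x <= Z n.+1 k x) ->
  forall n k, \sum_(j < n) \int[Pr]_(w in not_yet (k + j)) gain (k + j)%N (Phi (k + j)%N w) <=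
  \int[Pr]_(w in not_yet k) Z n k (Phi k w).
Proof.
move=> mgain gain0 mZ Z0 step; elim=> [|n ih] k.
  by rewrite big_ord0; exact: integral_ge0.
rewrite big_ord_recl addn0.
have -> : \sum_(i < n) \int[Pr]_(w in not_yet (k + lift ord0 i))
    gain (k + lift ord0 i)%N (Phi (k + lift ord0 i)%N w) =
    \sum_(i < n) \int[Pr]_(w in not_yet (k.+1 + i)) gain (k.+1 + i)%N (Phi (k.+1 + i)%N w).
  by apply: eq_bigr => i _; rewrite /= /bump/= add1n addSnnS.
apply: (le_trans (leeD2l _ (ih k.+1))).
rewrite integral_not_yetS//.
have mk := measurable_not_yet k.
have mc (h : T -> \bar R) : measurable_fun setT h -> measurable_fun (not_yet k) (fun w => h (Phi k w)).
  move=> mh; apply: measurable_funTS; exact: measurableT_comp mh (mPhi k).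
rewrite -ge0_integralD//; last 3 first.
- exact: mc.
- by move=> w _; apply: killed_ge0.
- by apply: mc; exact: measurable_killed.
apply: ge0_le_integral => //.
- by move=> w _; rewrite adde_ge0// killed_ge0.
- by apply: (mc (fun x => gain k x + killed (Z n k.+1) x)); apply: emeasurable_funD => //; exact: measurable_killed.
- exact: mc.
Qed.

End chain.
End killed_chain.

Section visits.
Context {R : realType} {d : measure_display} {T : measurableType d}.
Variables (P : R.-pker T ~> T) (B C : set T).
Hypotheses (mB : measurable B) (mC : measurable C).
Local Open Scope ereal_scope.

(** Expected number of visits to [C] before time [N] for the chain killed in [B]. *)
Fixpoint visits (N : nat) (x : T) : \bar R :=
  if N is N'.+1 then (\1_C x)%:E + killed P B (visits N') x else 0.

(** The probability that [B] is not entered during the first [n] steps. *)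
Definition survival (n : nat) : T -> \bar R := iter n (killed P B) (cst 1).

Lemma iter_killed_ge0 n (g : T -> \bar R) : (forall x, 0 <= g x) ->
  forall x, 0 <= iter n (killed P B) g x.
Proof. by move=> g0; elim: n => //= n ih; exact: killed_ge0. Qed.

Lemma measurable_iter_killed n (g : T -> \bar R) : measurable_fun setT g ->
  (forall x, 0 <= g x) -> measurable_fun setT (iter n (killed P B) g).
Proof.
move=> mg g0; elim: n => //= n ih.
by apply: measurable_killed => //; exact: iter_killed_ge0.
Qed.

Lemma visits_ge0 N x : 0 <= visits N x.
Proof.
by elim: N x => //= N ih x; rewrite adde_ge0 ?killed_ge0// lee_fin.
Qed.

Lemma measurable_visits N : measurable_fun setT (visits N).
Proof.
elim: N => [|N ih] /=; first exact: measurable_cst.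
apply: emeasurable_funD; last by apply: measurable_killed => //; exact: visits_ge0.
by apply/measurable_EFinP; exact: measurable_indic.
Qed.

Lemma le_iter_killed n (g1 g2 : T -> \bar R) :
  measurable_fun setT g1 -> measurable_fun setT g2 ->
  (forall x, 0 <= g1 x) -> (forall x, g1 x <= g2 x) ->
  forall x, iter n (killed P B) g1 x <= iter n (killed P B) g2 x.
Proof.
move=> m1 m2 g0 g12; have g20 x : 0 <= g2 x by exact: le_trans (g12 x).
elim: n => //= n ih x.
by apply: le_killed => //; [exact: measurable_iter_killed..|exact: iter_killed_ge0].
Qed.

Lemma iter_killedZ n (k : R) (g : T -> \bar R) : measurable_fun setT g ->
  (0 <= k)%R -> (forall x, 0 <= g x) -> forall x,
  iter n (killed P B) (fun x => k%:E * g x) x = k%:E * iter n (killed P B) g x.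
Proof.
move=> mg k0 g0; elim: n => //= n ih x.
rewrite (funext ih) killedZ//; first exact: measurable_iter_killed.
exact: iter_killed_ge0.
Qed.

Lemma killed_le_cst (k : R) (g : T -> \bar R) : measurable_fun setT g ->
  (forall x, 0 <= g x) -> (forall x, g x <= k%:E) -> (0 <= k)%R ->
  forall x, killed P B g x <= k%:E.
Proof.
move=> mg g0 gk k0 x.
apply: (@le_trans _ _ (killed P B (fun x => k%:E * cst 1 x) x)).
  by apply: le_killed => // y; rewrite /= mule1.
rewrite killedZ//.
by rewrite -[leRHS]mule1 lee_wpmul2l// killed1_le1.
Qed.

Let visits_split n N x :
  visits (n + N) x <= n%:R%:E + iter n (killed P B) (visits N) x.
Proof.
elim: n x => [x|n ih x]; first by rewrite add0e.
rewrite addSn /=.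
have mI := measurable_iter_killed n (measurable_visits N) (visits_ge0 N).
have I0 := iter_killed_ge0 n (visits_ge0 N).
have h1 : killed P B (visits (n + N)) x <=
    killed P B (fun y => n%:R%:E * cst 1 y + iter n (killed P B) (visits N) y) x.
  apply: le_killed => //; first exact: measurable_visits.
  - by apply: emeasurable_funD => //; apply: measurable_funeM; exact: measurable_cst.
  - exact: visits_ge0.
  - by move=> y; rewrite /= mule1; exact: ih.
rewrite killedD// in h1; last by move=> y; rewrite mule1 lee_fin.
rewrite killedZ// in h1.
have c1 : (\1_C x)%:E <= 1%:E :> \bar R by rewrite lee_fin indicE lern1 leq_b1.
have n0 : 0 <= n%:R%:E :> \bar R by rewrite lee_fin.
have h2 := le_trans h1 (leeD (lee_wpmul2l n0 (killed1_le1 P mB x)) (lexx _)).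
apply: (le_trans (leeD c1 h2)).
by rewrite mule1 addeA -EFinD -natr1 [(1 + _)%R]addrC.
Qed.

(** Each visit to [C] leads to [B] within [n] steps with probability at least
    [eps], so that the number of visits is dominated by [n] times a geometric
    variable. *)
Lemma visits_le n (eps : R) : (0 < eps <= 1)%R ->
  (forall x, C x -> survival n x + eps%:E <= 1) ->
  forall N x, visits N x <= (n%:R / eps)%:E.
Proof.
move=> /andP[eps0 eps1] hC.
set M := (n%:R / eps)%R.
have M0 : (0 <= M)%R by rewrite divr_ge0// ltW.
have nM : (n%:R <= M)%R by rewrite ler_pdivlMr// ler_piMr.
elim/ltn_ind => N ih x.
have [Nn|nN] := leqP N n.
  have := visits_split N 0 x; rewrite addn0 => /le_trans; apply.
  have -> : iter N (killed P B) (visits 0) x = 0.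
    elim: (N) x => //= k ihk x.
    by rewrite (funext ihk) /killed integral0.
  by rewrite adde0 lee_fin (le_trans _ nM)// ler_nat.
have [xC|xC] := pselect (C x).
  have NE : (n + (N - n))%N = N by rewrite subnKC// ltnW.
  have [n0|n0] := eqVneq n 0%N.
    by have := hC x xC; rewrite n0 /= -EFinD lee_fin gerDl leNgt eps0.
  have lt : (N - n < N)%N by rewrite ltn_subrL lt0n n0 (leq_ltn_trans _ nN).
  have := visits_split n (N - n) x; rewrite NE => /le_trans; apply.
  have h1 : iter n (killed P B) (visits (N - n)) x <= M%:E * survival n x.
    rewrite -iter_killedZ//.
    apply: le_iter_killed => //.
    - exact: measurable_visits.
    - exact: visits_ge0.
    - by move=> y; rewrite mule1; exact: ih.
  apply: (le_trans (leeD (lexx _) h1)).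
  have {1}-> : n%:R = (M * eps)%R :> R by rewrite /M divfK// gt_eqF.
  rewrite EFinM addeC -ge0_muleDr//; last 2 first.
  - exact: iter_killed_ge0.
  - by rewrite lee_fin ltW.
  by rewrite -[leRHS]mule1 lee_wpmul2l// hC.
case: N ih nN => // N ih _ /=.
rewrite indicE memNset// add0e.
apply: killed_le_cst => //; first exact: measurable_visits.
- exact: visits_ge0.
- by move=> y; exact: ih.
Qed.

(** Reach [D] first, then [B] from [D]; a direct hit of [B] only helps. *)
Lemma survivalS_le n (D : set T) (eps eta : R) x : measurable D ->
  (0 <= eps)%R -> (forall y, D y -> survival n y + eps%:E <= 1) ->
  eta%:E <= P x D -> survival n.+1 x + (eta * eps)%:E <= 1.
Proof.
move=> mD eps0 hD etaD.
have m1 : measurable_fun setT (cst 1 : T -> \bar R) by exact: measurable_cst.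
have mS : measurable_fun setT (survival n) by exact: measurable_iter_killed.
have S0 y : 0 <= survival n y by exact: iter_killed_ge0.
have S1 y : survival n y <= 1.
  elim: n {hD mS S0} y => [|k ih] y //=.
  by apply: killed_le_cst => // [|z]; [exact: measurable_iter_killed|exact: iter_killed_ge0].
have mI : measurable_fun setT (fun y : T => (\1_D y)%:E : \bar R).
  by apply/measurable_EFinP; exact: measurable_indic.
have h : \int[P x]_y (survival n y + eps%:E * (\1_D y)%:E) <= 1.
  rewrite -[leRHS](@prob_kernel _ _ _ _ _ P x) -[leRHS]mul1e -integral_cst//.
  apply: ge0_le_integral => //.
  - by move=> y _; rewrite adde_ge0// mule_ge0// lee_fin.
  - by apply: emeasurable_funD => //; exact: measurable_funeM.
  - move=> y _; rewrite indicE; have [yD|yD] := boolP (y \in D).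
      by rewrite mule1; apply: hD; exact/set_mem.
    by rewrite mule0 adde0.
rewrite ge0_integralD// in h; last 2 first.
- by move=> y _; rewrite mule_ge0// lee_fin.
- exact: measurable_funeM.
rewrite ge0_integralZl// ?lee_fin// in h.
rewrite integral_indic// setIT in h.
apply: le_trans h; apply: leeD; first by apply: killed_le_integral.
by rewrite mulrC EFinM lee_wpmul2l// lee_fin.
Qed.

End visits.

(** * Modulated moments *)

Section regularity.
Context {R : realType} {d : measure_display} {T : measurableType d}.
Variables (P : R.-pker T ~> T) (B : set T).
Hypothesis mB : measurable B.
Local Open Scope ereal_scope.

(** The terms of the sum live on the events where [B] has not been visited yet, so
    that the comparison for the killed chain applies. *)
Lemma modulated_moment_finite (lambda : probability T R) {dO : measure_display}
    {Omega : measurableType dO} (Pr : probability Omega R) (Phi : nat -> Omega -> T)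
    (f : T -> R) (r : nat -> R) (w : R) (gain : nat -> T -> \bar R)
    (Z : nat -> nat -> T -> \bar R) (V : T -> \bar R) :
  markov_chain P lambda Pr Phi ->
  measurable_fun setT f -> (forall x, 0 <= f x)%R -> (forall k, 0 <= r k)%R ->
  (0 <= w)%R ->
  (forall k, measurable_fun setT (gain k)) -> (forall k x, 0 <= gain k x) ->
  (forall k x, (r k * f x)%:E <= w%:E * gain k x) ->
  (forall n k, measurable_fun setT (Z n k)) -> (forall n k x, 0 <= Z n k x) ->
  (forall n k x, gain k x + killed P B (Z n k.+1) x <= Z n.+1 k x) ->
  measurable_fun setT V -> (forall n x, Z n 0%N x <= V x) ->
  \int[lambda]_x V x < +oo ->
  \int[Pr]_w (\sum_(0 <= k <oo | (k%:R%:E < return_time Phi B w :> \bar R)%E)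
      (r k * f (Phi k w))%:E) < +oo.
Proof.
move=> chain mf f0 r0 w0 mgain gain0 rf mZ Z0 step mV ZV V_fin.
have mPhi k : measurable_fun setT (Phi k) by case: chain.
have mrf k : measurable_fun setT (fun w => (r k * f (Phi k w))%:E : \bar R).
  by apply/measurable_EFinP; apply: measurable_funM => //; exact: measurableT_comp mf (mPhi k).
have mny k := measurable_not_yet mB chain k.
pose h k := (fun w => (r k * f (Phi k w))%:E : \bar R) \_ (not_yet B Phi k).
have h0 k v : 0 <= h k v.
  by rewrite /h /patch; case: ifPn => // _; rewrite lee_fin mulr_ge0.
have mh k : measurable_fun setT (h k).
  by apply/(measurable_restrictT _ _).1 => //; exact: measurable_funTS.
have mg k : measurable_fun (not_yet B Phi k) (fun w => gain k (Phi k w)).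
  by apply: measurable_funTS; exact: measurableT_comp (mgain k) (mPhi k).
have -> : (fun w => \sum_(0 <= k <oo | (k%:R%:E < return_time Phi B w :> \bar R)%E)
      (r k * f (Phi k w))%:E) = (fun w => \sum_(k <oo) h k w).
  apply/funext => v; rewrite eseries_mkcond; congr (limn _).
  apply/funext => N; apply: eq_bigr => k _.
  by rewrite /h /patch lt_return_time.
rewrite integral_nneseries//.
have ZB n : \sum_(j < n) \int[Pr]_(w in not_yet B Phi j) gain j (Phi j w) <=
    \int[lambda]_x V x.
  have := killed_comparison mB chain mgain gain0 mZ Z0 step n 0.
  rewrite not_yet0 => /le_trans; apply.
  apply: (@le_trans _ _ (\int[Pr]_w V (Phi 0%N w))).
    apply: ge0_le_integral => //.
    - exact: measurableT_comp (mZ n 0%N) (mPhi 0%N).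
    - exact: measurableT_comp mV (mPhi 0%N).
  have V0 x : 0 <= V x by exact: le_trans (Z0 0%N 0%N x) (ZV 0%N x).
  pose Phi0 : {mfun Omega >-> T} :=
    HB.pack (Phi 0%N) (isMeasurableFun.Build _ _ _ _ _ (mPhi 0%N)).
  rewrite -(@ge0_integral_pushforward _ _ _ _ _ _ (mPhi 0%N) Pr setT V)//.
  rewrite le_eqVlt; apply/orP; left; apply/eqP.
  apply: eq_measure_integral => A mA _.
  by case: chain => _ + _; exact.
apply: (@le_lt_trans _ _ (w%:E * \int[lambda]_x V x)); last first.
  by rewrite lte_mul_pinfty// lee_fin.
apply: lime_le.
  by apply: is_cvg_nneseries => k _ _; exact: integral_ge0.
apply: nearW => N; rewrite big_mkord.
apply: (@le_trans _ _ (w%:E * \sum_(j < N) \int[Pr]_(w in not_yet B Phi j) gain j (Phi j w))).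
  rewrite ge0_sume_distrr; last first.
    by move=> j _; exact: integral_ge0.
  apply: lee_sum => j _; rewrite /h -integral_mkcond -ge0_integralZl//.
  apply: ge0_le_integral => //.
  - by move=> v _; rewrite lee_fin mulr_ge0.
  - exact: measurable_funTS.
  - exact: measurable_funeM.
by rewrite lee_wpmul2l ?lee_fin.
Qed.

End regularity.

(** * The Metropolis kernel *)

Section metropolis_kernel.
Context {R : realType} {n : nat}.
Implicit Types (x y z : 'rV[R]_n) (D : set 'rV[R]_n).
Local Notation mu := (lebesgue_rV R n).

Lemma continuous_measurable_rV (f : 'rV[R]_n -> R) : continuous f ->
  measurable_fun setT f.
Proof.
move=> cf; apply: (@measurability _ _ _ _ _ _ (@RGenOpens.G R)).
  exact: RGenOpens.measurableE.
move=> _ [_ [a [b ->]] <-]; rewrite setTI; apply: open_measurable_rV.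
by apply: open_comp; [move=> v _; exact: cf|exact: interval_open].
Qed.

Lemma measurable_translate_rV x : measurable_fun setT (fun y => x + y).
Proof.
apply: measurable_fun_rV => i; under eq_fun do rewrite mxE.
by apply: measurable_funD => //; exact: measurable_coord_rV.
Qed.

Lemma measurable_oppr_rV : measurable_fun setT (fun y : 'rV[R]_n => - y).
Proof.
apply: measurable_fun_rV => i; under eq_fun do rewrite mxE.
by apply: measurable_funN; exact: measurable_coord_rV.
Qed.

Lemma ge0_integral_opp_rV (f : 'rV[R]_n -> \bar R) : measurable_fun setT f ->
  (forall y, 0 <= f y)%E -> (\int[mu]_y f (- y)%R = \int[mu]_y f y)%E.
Proof.
move=> mf f0.
rewrite -(@ge0_integral_pushforward _ _ _ _ _ _ measurable_oppr_rV mu setT f)//.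
apply: eq_measure_integral => [|? A mA _]; first exact: measurable_oppr_rV.
exact: lebesgue_rV_opp.
Qed.

Variables (pi q : 'rV[R]_n -> R).
Hypotheses (mpi : measurable_fun setT pi) (pi0 : forall x, 0 < pi x).
Hypothesis q_density : is_density q.

Let mq : measurable_fun setT q. Proof. by case: q_density. Qed.
Let q0 y : 0 <= q y. Proof. by case: q_density => _ + _; exact. Qed.

Lemma acceptanceE x y : acceptance pi x y = Num.min (pi y / pi x) 1.
Proof. by rewrite /acceptance pi0. Qed.

Lemma acceptance_ge0 x y : 0 <= acceptance pi x y.
Proof. by rewrite acceptanceE le_min ler01 divr_ge0// ltW. Qed.

Lemma acceptance_le1 x y : acceptance pi x y <= 1.
Proof. by rewrite acceptanceE ge_min lexx orbT. Qed.

Lemma measurable_acceptance x :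
  measurable_fun setT (fun y => acceptance pi x (x + y)).
Proof.
under eq_fun do rewrite acceptanceE.
apply: measurable_minr => //; apply: measurable_funM => //.
exact: measurableT_comp mpi (measurable_translate_rV x).
Qed.

Let macc x := measurable_acceptance x.

Let maq x : measurable_fun setT (fun y => (acceptance pi x (x + y) * q y)%:E : \bar R).
Proof. by apply/measurable_EFinP; exact: measurable_funM. Qed.

Let aq0 x y : (0 <= (acceptance pi x (x + y) * q y)%:E :> \bar R)%E.
Proof. by rewrite lee_fin mulr_ge0// acceptance_ge0. Qed.

Let rq0 x y : 0 <= (1 - acceptance pi x (x + y)) * q y.
Proof. by rewrite mulr_ge0// subr_ge0 acceptance_le1. Qed.

Let mrq x : measurable_fun setT (fun y => ((1 - acceptance pi x (x + y)) * q y)%:E : \bar R).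
Proof. by apply/measurable_EFinP; apply: measurable_funM => //; exact: measurable_funB. Qed.

Let rejection x : \bar R :=
  (\int[mu]_y ((1 - acceptance pi x (x + y)) * q y)%:E)%E.

Let rejection_ge0 x : (0 <= rejection x)%E.
Proof. by apply: integral_ge0 => y _; rewrite lee_fin. Qed.

Let rejection_fin x : rejection x \is a fin_num.
Proof.
rewrite ge0_fin_numE// (@le_lt_trans _ _ (\int[mu]_y (q y)%:E)%E)//; last first.
  by case: q_density => _ _ ->; exact: ltry.
apply: ge0_le_integral => //.
- by move=> y _; rewrite lee_fin.
- by apply/measurable_EFinP.
- by move=> y _; rewrite lee_fin ler_piMl// gerBl acceptance_ge0.
Qed.

Variable P : R.-pker 'rV[R]_n ~> 'rV[R]_n.
Hypothesis hP : is_metropolis_kernel pi q P.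

Lemma metropolis_integralE x (g : 'rV[R]_n -> \bar R) : measurable_fun setT g ->
  (forall y, 0 <= g y)%E ->
  (\int[P x]_y g y =
   \int[mu]_y (g (x + y)%R * (acceptance pi x (x + y) * q y)%:E) +
   g x * \int[mu]_y ((1 - acceptance pi x (x + y)) * q y)%:E)%E.
Proof.
move=> mg g0; apply/esym.
have mc (h : 'rV[R]_n -> \bar R) : measurable_fun setT h ->
    measurable_fun setT (fun y => h (x + y)%R * (acceptance pi x (x + y) * q y)%:E)%E.
  move=> mh; apply: emeasurable_funM => //.
  exact: measurableT_comp mh (measurable_translate_rV x).
have c0 (h : 'rV[R]_n -> \bar R) : (forall y, 0 <= h y)%E -> forall y,
    (0 <= h (x + y)%R * (acceptance pi x (x + y) * q y)%:E)%E.
  by move=> h0 y; rewrite mule_ge0.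
apply: (@ge0_integral_functionalE _ _ _ (P x) (fun h : 'rV[R]_n -> \bar R =>
  \int[mu]_y (h (x + y)%R * (acceptance pi x (x + y) * q y)%:E) +
  h x * rejection x)%E) => //.
- move=> A mA; rewrite hP// /metropolis.
  by congr (_ + _)%E; apply: eq_integral => y _; rewrite -EFinM mulrA.
- move=> f h mf mh f0 h0.
  under eq_integral do rewrite ge0_muleDl//.
  rewrite ge0_integralD//; [|by move=> y _; exact: c0|exact: mc|
    by move=> y _; exact: c0|exact: mc].
  by rewrite ge0_muleDl// addeACA.
- move=> k f mf f0 k0.
  under eq_integral do rewrite -muleA.
  rewrite ge0_integralZl//; [|exact: mc|by move=> y _; exact: c0].
  rewrite -(muleA k%:E (f x) (rejection x)) [RHS]ge0_muleDr//.
  + by apply: integral_ge0 => y _; exact: c0.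
  + exact: mule_ge0.
- move=> f mf f0 ndf.
  have cvgf y : cvgn (f ^~ y) by apply: ereal_nondecreasing_is_cvgn; exact: ndf.
  have ndc y : nondecreasing_seq (fun j =>
      f j (x + y)%R * (acceptance pi x (x + y) * q y)%:E)%E.
    by move=> a b ab; rewrite lee_wpmul2r//; exact: ndf.
  have nds : nondecreasing_seq (fun j =>
      \int[mu]_y (f j (x + y)%R * (acceptance pi x (x + y) * q y)%:E))%E.
    move=> a b ab; apply: ge0_le_integral => //.
    + by move=> y _; exact: c0.
    + exact: mc.
    + exact: mc.
    + by move=> y _; exact: ndc.
  have is0 j : (0 <= \int[mu]_y (f j (x + y)%R
      * (acceptance pi x (x + y) * q y)%:E))%E.
    by apply: integral_ge0 => y _; exact: c0.
  transitivity (\int[mu]_y limn (fun j =>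
      f j (x + y)%R * (acceptance pi x (x + y) * q y)%:E) +
      limn (fun j => f j x * rejection x))%E.
    congr (_ + _)%E; last by rewrite limeMr.
    by apply: eq_integral => y _; rewrite limeMr.
  rewrite monotone_convergence//; last 2 first.
    + by move=> j; exact: mc.
    + by move=> j y _; exact: c0.
  have c1 := ereal_nondecreasing_is_cvgn nds.
  have c2 : cvgn (fun j => f j x * rejection x)%E.
    apply: ereal_nondecreasing_is_cvgn => a b ab.
    by rewrite lee_wpmul2r//; exact: ndf.
  rewrite -limeD//; apply: ge0_adde_def; rewrite inE; apply: lime_ge => //.
    exact: nearW.
  by apply: nearW => j; rewrite mule_ge0.
Qed.

(** Rejections only add to the mass of [D]. *)
Lemma metropolis_ge x D (e a : R) (delta : R) : measurable D -> 0 <= a -> 0 <= e ->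
  (forall y, ball 0 delta y -> e <= q y) ->
  (forall y, D y -> ball x delta y /\ a <= acceptance pi x y) ->
  ((e * a)%:E * mu D <= P x D)%E.
Proof.
move=> mD a0 e0 eq ha; rewrite hP// /metropolis.
rewrite -[leLHS]adde0; apply: leeD; last first.
  by apply: mule_ge0; [rewrite lee_fin|exact: rejection_ge0].
have mxD : measurable ((fun y => x + y) @^-1` D).
  rewrite -[X in measurable X]setTI; exact: measurable_translate_rV.
rewrite -(lebesgue_rV_translate x mD) -[X in (_ * mu X)%E]setIT.
rewrite -integral_indic// -ge0_integralZl//; last 2 first.
- by apply/measurable_EFinP; exact: measurable_indic.
- by rewrite lee_fin mulr_ge0.
apply: ge0_le_integral => //.
- by move=> y _; rewrite mule_ge0// lee_fin// mulr_ge0.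
- by apply: measurable_funeM; apply/measurable_EFinP; exact: measurable_indic.
- apply/measurable_EFinP; apply: measurable_funM => //; apply: measurable_funM => //.
  apply: (measurableT_comp _ (measurable_translate_rV x)).
  exact: measurable_indic.
- move=> y _; rewrite lee_fin !indicE.
  have -> : (y \in [eta +%R x] @^-1` D) = (x + y \in D).
    by apply/idP/idP => /set_mem h; exact/mem_set.
  have [yD|yD] := boolP (x + y \in D); last by rewrite mulr0 !mul0r.
  rewrite mulr1 mul1r mulrC.
  have [xy axy] := ha _ (set_mem yD).
  apply: ler_pM => //; apply: eq; move: xy.
  by rewrite -!ball_normE/= opprD addNKr sub0r.
Qed.

Lemma metropolis_null x D : measurable D -> mu D = 0%E -> ~ D x ->
  P x D = 0%E.
Proof.
move=> mD D0 xD; rewrite hP// /metropolis indicE memNset// mul0e adde0.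
have mxD : measurable ((fun y => x + y) @^-1` D).
  rewrite -[X in measurable X]setTI; exact: measurable_translate_rV.
rewrite (@ge0_negligible_integral _ _ _ mu setT ((fun y => x + y) @^-1` D))//.
- rewrite integral0_eq// => y [_ yD].
  by rewrite indicE memNset// !mul0r.
- apply/measurable_EFinP; apply: measurable_funM => //; apply: measurable_funM => //.
  apply: (measurableT_comp _ (measurable_translate_rV x)).
  exact: measurable_indic.
- by move=> y _; rewrite lee_fin !mulr_ge0// acceptance_ge0.
- by rewrite -D0; exact: lebesgue_rV_translate.
Qed.

(** From outside a null set [D], a rejected move stays outside [D] and an accepted
    one almost surely leads outside [D]. *)
Lemma metropolis_iter_null D : measurable D -> mu D = 0%E ->
  forall k x, ~ D x -> kernel_iter P k x D = 0%E.
Proof.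
move=> mD D0; elim=> [|k ih] x xD /=; first by rewrite diracE memNset.
have k0 i z : (0 <= kernel_iter P i z D)%E.
  by elim: i z => [|i ihi] z /=; [exact: measure_ge0|exact: integral_ge0].
have mk : measurable_fun setT (fun y => kernel_iter P k y D).
  elim: (k) => [|j ihj] /=.
    under eq_fun do rewrite diracE -[_%:R]indicE.
    by apply/measurable_EFinP; exact: measurable_indic.
  apply: measurable_fun_integral_kernel => //.
  by move=> U mU; exact: measurable_kernel.
rewrite (@ge0_negligible_integral _ _ _ (P x) setT D)//.
- by rewrite integral0_eq// => y [_ yD]; exact: ih.
- exact: metropolis_null.
Qed.

(** If [D] were null, it would not be accessible from its complement, hence would
    be the whole space. *)
Lemma lebesgue_gt0_of_irreducible (psi : {sigma_finite_measure set 'rV[R]_n -> \bar R}) D :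
  irreducibility_measure P psi -> measurable D -> (0 < psi D)%E -> (0 < mu D)%E.
Proof.
move=> [_ irr] mD psiD; rewrite lt0e measure_ge0 andbT; apply/eqP => D0.
have [DT|] := pselect (D = setT).
  have [_ _] := q_density; rewrite -DT null_set_integral// ?DT//.
    by move=> /eqP; rewrite lt_eqF// lte01.
  by apply/measurable_EFinP.
move=> DT; apply: DT; apply/seteqP; split => // x _; apply: contrapT => xD.
by have [k _] := irr x D mD psiD; rewrite metropolis_iter_null// ltxx.
Qed.

End metropolis_kernel.

(** * Reaching a set of positive measure *)

Section reaching.
Context {R : realType} {n : nat}.
Implicit Types (x y z : 'rV[R]_n).
Local Notation mu := (lebesgue_rV R n).

Lemma pos_real_below (e : \bar R) : (0 < e)%E ->
  exists2 b : R, 0 < b & (b%:E <= e)%E.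
Proof.
case: e => [r r0| _|//]; first by exists r.
by exists 1 => //; rewrite leey.
Qed.

Lemma compact_cball z (rho : R) : compact [set x | `|x - z| <= rho].
Proof.
apply: bounded_closed_compact.
  exists (`|z| + rho); split; first by rewrite num_real.
  move=> M zM x /= xz; rewrite (le_trans _ (ltW zM))//.
  by rewrite -[x in `|x|](subrK z) addrC (le_trans (ler_normD _ _))// lerD2l.
rewrite (_ : mkset _ = (fun x => `|x - z|) @^-1` [set r | r <= rho])//.
apply: preimage_closed; last exact: closed_le.
move=> x _; apply: continuous_comp; last exact: norm_continuous.
by apply: continuousB; [exact: cvg_id|exact: cst_continuous].
Qed.

Lemma pos_continuous_bounds (f : 'rV[R]_n -> R) z (rho : R) :
  continuous f -> (forall x, 0 < f x) -> 0 <= rho ->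
  exists a b, 0 < a /\ forall x, `|x - z| <= rho -> a <= f x <= b.
Proof.
move=> cf f0 rho0.
have K0 : [set x | `|x - z| <= rho] !=set0.
  by exists z => /=; rewrite subrr normr0.
have cK := @compact_cball z rho.
have cfK : {within [set x | `|x - z| <= rho], continuous f}.
  exact: continuous_subspaceT.
have [c _ cmin] := compact_EVT_min K0 cK cfK.
have [e _ emax] := compact_EVT_max K0 cK cfK.
exists (f c), (f e); split => // x xz.
by rewrite cmin ?emax ?inE.
Qed.

Variables (pi q : 'rV[R]_n -> R).
Hypotheses (cpi : continuous pi) (pi0 : forall x, 0 < pi x).
Hypothesis q_density : is_density q.
Variable P : R.-pker 'rV[R]_n ~> 'rV[R]_n.
Hypothesis hP : is_metropolis_kernel pi q P.

Let mpi : measurable_fun setT pi.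
Proof. exact: continuous_measurable_rV. Qed.

(** A set [B] of positive measure charges a small ball around some [z]. From any
    point, moving towards [z] by steps shorter than the radius on which [q] is
    bounded below leads to [B] in a bounded number of steps, with a probability
    bounded below on bounded sets. *)
Lemma survival_lt1 (e delta : R) (B : set 'rV[R]_n) (rad : R) :
  0 < e -> 0 < delta -> (forall y, ball 0 delta y -> e <= q y) ->
  measurable B -> (0 < mu B)%E ->
  exists k (eps : R), 0 < eps <= 1 /\
    forall x, `|x| <= rad -> (survival P B k x + eps%:E <= 1)%E.
Proof.
move=> e0 d0 qe mB B0.
have [z Bz] : exists z, (0 < mu (B `&` ball z (delta / 4)))%E.
  by apply: lebesgue_gt0_ball => //; lra.
set rho := `|z| + `|rad| + delta.
have z0 : 0 <= `|z| by [].
have r0 : 0 <= `|rad| by [].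
have rho0 : 0 < rho by rewrite /rho; lra.
have rhod : delta <= rho by rewrite /rho; lra.
have [p1 [p2 [p10 hp]]] := pos_continuous_bounds z cpi pi0 (ltW rho0).
have [/andP[p12 _] p20] : p1 <= pi z <= p2 /\ 0 < p2.
  have h : p1 <= pi z <= p2 by apply: hp; rewrite subrr normr0 ltW.
  by split => //; move: h => /andP[? ?]; lra.
set a := Num.min (p1 / p2) 1.
have a0 : 0 < a by rewrite lt_min ltr01 divr_gt0.
have ha x y : `|x - z| <= rho -> `|y - z| <= rho -> a <= acceptance pi x y.
  move=> /hp /andP[x1 x2] /hp/andP[y1 y2]; rewrite acceptanceE//.
  rewrite le_min; apply/andP; split; last by rewrite ge_min lexx orbT.
  rewrite ge_min; apply/orP; left.
  by apply: ler_pM; rewrite ?invr_ge0 ?(ltW p10) ?(ltW p20)// lef_pV2// posrE.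
have [b bpos hb] := pos_real_below Bz.
(* Going from [x] the fraction [t] of the way to [z] is a step of length at most
   [delta / 2]; landing within [eta] of that point brings the chain closer to [z] by
   at least [eta], until it is within [delta / 2] of [z]. *)
set t := delta / (2 * rho).
have t0 : 0 < t by rewrite divr_gt0 ?mulr_gt0.
have trho : t * rho = delta / 2 by rewrite /t; field; rewrite gt_eqF.
have t1 : t <= 1 by rewrite /t ler_pdivrMr ?mulr_gt0//; lra.
set eta := t * delta / 4.
have eta0 : 0 < eta by apply: divr_gt0 => //; exact: mulr_gt0.
have [c c0 hc] := pos_real_below (lebesgue_ball_gt0 (0 : 'rV[R]_n) eta0).
have claim j : exists2 eps, 0 < eps & forall x, `|x - z| <= delta / 2 + j%:R * eta ->
    `|x - z| <= rho -> (survival P B j.+1 x + eps%:E <= 1)%E.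
  elim: j => [|j [eps eps0 ih]].
    exists (e * a * b) => [|x]; first by rewrite !mulr_gt0.
    rewrite mul0r addr0 => xz xrho.
    have mD : measurable (B `&` ball z (delta / 4)).
      by apply: measurableI => //; exact: measurable_ball_rV.
    have h : ((e * a * b)%:E <= P x B)%E.
      apply: (@le_trans _ _ (P x (B `&` ball z (delta / 4)))); last first.
        by rewrite le_measure// ?inE//; exact: subIsetl.
      apply: (@le_trans _ _ ((e * a)%:E * mu (B `&` ball z (delta / 4)))%E).
        by rewrite EFinM lee_wpmul2l// lee_fin mulr_ge0// ltW.
      apply: (metropolis_ge mpi pi0 q_density hP mD (ltW a0) (ltW e0) qe).
      move=> y [_]; rewrite -!ball_normE/= => yz; split.
        have := ler_distD z x y; lra.
      by apply: ha => //; rewrite distrC; lra.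
    rewrite /survival/= /killed integral_cst ?mul1e; last exact: measurableC.
    apply: (@le_trans _ _ (P x (~` B) + P x B)%E); first exact: leeD.
    rewrite -measureU//; last 2 first.
      exact: measurableC.
      by rewrite setICl.
    by rewrite setvU -[leRHS](@prob_kernel _ _ _ _ _ P x).
  exists (e * a * c * eps) => [|x]; first by rewrite !mulr_gt0.
  move=> xz xrho.
  set x' := x + t *: (z - x).
  have x'x : `|x - x'| <= delta / 2.
    rewrite /x' opprD addNKr normrN normrZ (gtr0_norm t0) -trho distrC.
    by rewrite ler_pM2l.
  have x'z : `|x' - z| = (1 - t) * `|x - z|.
    have -> : x' - z = (1 - t) *: (x - z).
      apply/rowP => i; rewrite !mxE; ring.
    by rewrite normrZ ger0_norm// subr_ge0.
  have hD y : ball x' eta y -> `|y - z| <= delta / 2 + j%:R * eta /\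
      `|y - z| <= rho /\ `|x - y| < delta.
    rewrite -ball_normE/= => yx'.
    have h1 := ler_distD x' y z; have h2 := ler_distD x' x y.
    rewrite distrC in yx'.
    have jeta : 0 <= j%:R * eta by rewrite mulr_ge0// ltW.
    have xz0 : 0 <= `|x - z| by [].
    have etaE : eta = t * delta / 4 by [].
    have h3 : `|x' - z| <= (1 - t) * (delta / 2 + j.+1%:R * eta).
      by rewrite x'z ler_wpM2l// subr_ge0.
    have h4 : `|x' - z| <= (1 - t) * rho by rewrite x'z ler_wpM2l// subr_ge0.
    have h5 : 0 <= t * (j.+1%:R * eta).
      by apply: mulr_ge0; [exact: ltW|apply: mulr_ge0; [exact: ler0n|exact: ltW]].
    have eta4 : eta <= delta / 4.
      by rewrite etaE ler_pM2r// ler_piMl// ltW.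
    have h6 : (1 - t) * (delta / 2 + j.+1%:R * eta) =
       delta / 2 + j%:R * eta + eta - t * delta / 2 - t * (j.+1%:R * eta).
      by rewrite -natr1; ring.
    split; [|split].
    - by rewrite etaE in h1 h3 h5 h6 yx' *; lra.
    - by lra.
    - by rewrite (distrC x' y) in h2; lra.
  apply: (@survivalS_le _ _ _ P B mB j.+1 (ball x' eta) eps) => //.
  - exact: measurable_ball_rV.
  - exact: ltW.
  - by move=> y /hD[? [? _]]; exact: ih.
  - apply: (@le_trans _ _ ((e * a)%:E * mu (ball x' eta))%E).
      by rewrite lebesgue_ballE// EFinM lee_wpmul2l// lee_fin mulr_ge0// ltW.
    apply: (metropolis_ge mpi pi0 q_density hP _ (ltW a0) (ltW e0) qe).
      exact: measurable_ball_rV.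
    move=> y /hD[_ [h1 h2]]; split; first by rewrite -ball_normE.
    exact: ha.
have [j hj] : exists j : nat, rho <= j%:R * eta.
  exists (Num.bound (rho / eta)); rewrite -ler_pdivrMr//.
  by apply/ltW/archi_boundP; rewrite divr_ge0// ltW.
have [eps eps0 heps] := claim j.
exists j.+1, (Num.min eps 1); split; first by rewrite lt_min eps0 ltr01 ge_min lexx orbT.
move=> x xrad.
have xz : `|x - z| <= rho.
  rewrite (le_trans (ler_normB _ _))// /rho; have := ler_norm rad; lra.
apply: le_trans (heps x _ xz); last by lra.
by rewrite leeD2l// lee_fin ge_min lexx.
Qed.

End reaching.

(** * Second order expansion along a segment *)

Section euclidean_facts.
Context {R : realType} {n : nat}.
Implicit Types (x y g : 'rV[R]_n).

Lemma dotrv_ge0 x : 0 <= dotrv x x.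
Proof. by apply: sumr_ge0 => i _; rewrite -expr2 sqr_ge0. Qed.

Lemma enorm_ge0 x : 0 <= enorm x.
Proof. exact: sqrtr_ge0. Qed.

Lemma sqr_enorm x : enorm x ^+ 2 = dotrv x x.
Proof. by rewrite sqr_sqrtr// dotrv_ge0. Qed.

Lemma coord_le_enorm x i : `|x 0 i| <= enorm x.
Proof.
rewrite -(@ler_pXn2r _ 2)// ?nnegrE ?enorm_ge0// sqr_enorm.
rewrite real_normK ?num_real// /dotrv (bigD1 i)//= -expr2 lerDl.
by apply: sumr_ge0 => j _; rewrite -expr2 sqr_ge0.
Qed.

Lemma norm_le_enorm x : `|x| <= enorm x.
Proof. by apply: norm_le_coord => [|i]; [exact: enorm_ge0|exact: coord_le_enorm]. Qed.

Lemma enormN x : enorm (- x) = enorm x.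
Proof.
by congr Num.sqrt; apply: eq_bigr => i _; rewrite mxE mulrNN.
Qed.

Lemma measurable_enorm : measurable_fun setT (@enorm R n).
Proof.
have m2 : measurable_fun setT (fun x : 'rV[R]_n => dotrv x x).
  by apply: measurable_sum => i; apply: measurable_funM; exact: measurable_coord_rV.
apply: measurableT_comp m2.
by apply: continuous_measurable_fun; exact: sqrt_continuous.
Qed.

(** Coordinatewise, [(a + b) ^+ 2 >= a ^+ 2 / 2 - b ^+ 2]. *)
Lemma half_enorm_le x y t : 2 * enorm y <= enorm x -> `|t| <= 1 ->
  enorm x / 2 <= enorm (x + t *: y).
Proof.
move=> yx t1; rewrite -(@ler_pXn2r _ 2)// ?nnegrE ?divr_ge0 ?enorm_ge0//.
rewrite exprMn !sqr_enorm.
have h : dotrv x x / 2 - dotrv y y <= dotrv (x + t *: y) (x + t *: y).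
  rewrite /dotrv mulr_suml -sumrB; apply: ler_sum => i _; rewrite !mxE.
  have t2 : t ^+ 2 <= 1 by rewrite -[t ^+ 2]real_normK ?num_real// exprn_ile1.
  have : 0 <= (x 0 i / 2 + t * y 0 i) ^+ 2 by exact: sqr_ge0.
  have : t ^+ 2 * (y 0 i) ^+ 2 <= 1 * (y 0 i) ^+ 2 by rewrite ler_wpM2r ?sqr_ge0.
  have := sqr_ge0 (x 0 i).
  rewrite !expr2; nra.
have h2 : (2 * enorm y) ^+ 2 <= enorm x ^+ 2.
  by rewrite lerXn2r// nnegrE ?mulr_ge0 ?enorm_ge0.
rewrite exprMn !sqr_enorm in h2; move: h2 h; lra.
Qed.

Lemma dotrv_le g y : `|dotrv g y| <= n%:R * (enorm g * `|y|).
Proof.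
rewrite (le_trans (ler_norm_sum _ _ _))//.
rewrite (_ : n%:R * _ = \sum_(i < n) enorm g * `|y|); last first.
  by rewrite sumr_const card_ord mulr_natl.
by apply: ler_sum => i _; rewrite normrM ler_pM// ?coord_le_enorm// norm_coord_le.
Qed.

End euclidean_facts.

Section taylor.
Context {R : realType} {n : nat}.
Implicit Types (x y a : 'rV[R]_n) (f : 'rV[R]_n -> R).

Let line_quotient f x y (t : R) :
  (fun h : R => h^-1 *: (((fun s : R => f (x + s *: y)) \o shift t) (h *: 1) -
     f (x + t *: y))) =
  (fun h : R => h^-1 *: ((f \o shift (x + t *: y)) (h *: y) - f (x + t *: y))).
Proof.
apply/funext => h; congr (_ *: (f _ - _)) => /=.
by rewrite [h%:A]mulr1 scalerDl addrCA.
Qed.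

Lemma is_derive_line f x y (t : R) : derivable f (x + t *: y) y ->
  is_derive t 1 (fun s : R => f (x + s *: y)) ('D_y f (x + t *: y)).
Proof.
move=> df; split; first by rewrite /derivable line_quotient.
by rewrite /derive line_quotient.
Qed.

Lemma derive_partial f a y : differentiable f a ->
  'D_y f a = \sum_i y 0 i * partial i f a.
Proof.
move=> df; rewrite deriveE//.
rewrite [in LHS](row_sum_delta y) linear_sum; apply: eq_bigr => i _.
by rewrite linearZ /partial deriveE.
Qed.

(** Two applications of the mean value theorem along the segment from [x] to
    [x + y]. *)
Lemma taylor_hessian f (K : R) x y :
  (forall t : R, 0 <= t <= 1 -> differentiable f (x + t *: y)) ->
  (forall (t : R) i, 0 <= t <= 1 -> exists2 G, differentiable G (x + t *: y) &
     \forall z \near (x + t *: y), partial i f z = G z) ->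
  (forall t : R, 0 <= t <= 1 -> `|hessian f (x + t *: y)| <= K) ->
  `|f (x + y) - f x - dotrv (gradient f x) y| <= (n%:R * `|y|) ^+ 2 * K.
Proof.
move=> df dG hK.
pose h1 (s : R) := dotrv (gradient f (x + s *: y)) y.
pose h2 (s : R) := \sum_i y 0 i * \sum_j y 0 j * partial j (partial i f) (x + s *: y).
have d1 (t : R) : 0 <= t <= 1 -> is_derive t 1 (fun s : R => f (x + s *: y)) (h1 t).
  move=> t01; have -> : h1 t = 'D_y f (x + t *: y).
    rewrite derive_partial; last exact: df.
    by apply: eq_bigr => i _; rewrite mxE mulrC.
  by apply: is_derive_line; apply: diff_derivable; exact: df.
have d2 (t : R) : 0 <= t <= 1 -> is_derive t 1 h1 (h2 t).
  move=> t01.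
  have -> : h1 = \sum_i (y 0 i \*: (fun s : R => partial i f (x + s *: y))).
    apply/funext => s; rewrite fct_sumE; apply: eq_bigr => i _.
    by rewrite mxE mulrC.
  apply: is_derive_sum => i; apply: is_deriveZ.
  have [G dGt fG] := dG t i t01.
  have Gf : \forall z \near (x + t *: y), G z = partial i f z.
    by near do apply/esym.
  have -> : \sum_j y 0 j * partial j (partial i f) (x + t *: y) =
      'D_y (partial i f) (x + t *: y).
    rewrite (near_eq_derive _ fG) derive_partial//.
    by apply: eq_bigr => j _; rewrite /partial (near_eq_derive _ fG).
  apply: is_derive_line.
  have dGy := @diff_derivable _ _ _ _ _ y dGt.
  have dfy := near_eq_derivable Gf dGy.
  exact: dfy.
have in01 (a b t : R) : 0 <= a -> b <= 1 -> t \in `]a, b[ -> 0 <= t <= 1.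
  by move=> a0 b1; rewrite in_itv/= => /andP[? ?]; apply/andP; split; lra.
have in01' (a b t : R) : 0 <= a -> b <= 1 -> t \in `[a, b] -> 0 <= t <= 1.
  by move=> a0 b1; rewrite in_itv/= => /andP[? ?]; apply/andP; split; lra.
have [||xi] := @MVT_segment R (fun s => f (x + s *: y)) h1 0 1 ler01.
  by move=> t /(in01 _ _ _ (lexx 0) (lexx 1)); exact: d1.
  apply: derivable_within_continuous => t /(in01' _ _ _ (lexx 0) (lexx 1)) t01.
  by have [] := d1 t t01.
move=> xi01; rewrite scale1r scale0r addr0 subr0 mulr1 => ->.
have xi1 := in01' _ _ _ (lexx 0) (lexx 1) xi01.
have /andP[xi0 xi1'] := xi1.
have [||c] := @MVT_segment R h1 h2 0 xi xi0.
  by move=> t /(in01 _ _ _ (lexx 0) xi1'); exact: d2.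
  apply: derivable_within_continuous => t /(in01' _ _ _ (lexx 0) xi1') t01.
  by have [] := d2 t t01.
move=> /(in01' _ _ _ (lexx 0) xi1') c01.
rewrite {2}/h1 scale0r addr0 => ->.
rewrite subr0 normrM.
have K0 : 0 <= K by rewrite (le_trans _ (hK c c01)).
have hc : `|h2 c| <= (n%:R * `|y|) ^+ 2 * K.
  have -> : (n%:R * `|y|) ^+ 2 * K = \sum_(i < n) `|y| * \sum_(j < n) `|y| * K.
    by rewrite !sumr_const !card_ord -[_ *+ n]mulr_natl -[in RHS]mulr_natl; ring.
  rewrite (le_trans (ler_norm_sum _ _ _))//; apply: ler_sum => i _.
  rewrite normrM ler_pM// ?norm_coord_le//.
  rewrite (le_trans (ler_norm_sum _ _ _))//; apply: ler_sum => j _.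
  rewrite normrM ler_pM// ?norm_coord_le//.
  apply: le_trans (hK c c01).
  rewrite [leRHS]/Num.norm/= mx_normrE.
  by apply/bigmax_geP; right; exists (i, j) => //=; rewrite mxE.
rewrite -[leRHS]mulr1 ler_pM// (ger0_norm xi0)//.
Unshelve. all: by end_near. Qed.

End taylor.

(** * Second moment of the increments and regularity of the potential *)

Section second_moment.
Context {R : realType} {n : nat}.
Local Notation mu := (lebesgue_rV R n).

(** On the box where [y] has coordinates of the signs of those of [g] and of size
    at least [delta / 4], no cancellation occurs in the scalar product. *)
Lemma second_moment_ge (q : 'rV[R]_n -> R) (e delta : R) :
  measurable_fun setT q -> (forall y, 0 <= q y) -> 0 < e -> 0 < delta ->
  (forall y, ball 0 delta y -> e <= q y) ->
  exists2 sigma, 0 < sigma & forall g : 'rV[R]_n,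
    ((sigma * enorm g ^+ 2)%:E <= \int[mu]_y (dotrv g y ^+ 2 * q y)%:E)%E.
Proof.
move=> mq q0 e0 d0 qe.
have V0 : (0 < \prod_(i < n) (delta / 4)%:E :> \bar R)%E.
  elim/big_ind : _ => [|u v|i _]; [exact: lte01|exact: mule_gt0|].
  by rewrite lte_fin divr_gt0.
have [v v0 hv] := pos_real_below V0.
exists ((delta / 4) ^+ 2 * e * v) => [|g]; first by rewrite !mulr_gt0 ?exprn_gt0 ?divr_gt0.
pose A (i : 'I_n) : set R := if 0 <= g 0 i then `](delta / 4), (delta / 2)[%classic
  else `](- (delta / 2)), (- (delta / 4))[%classic.
pose D := [set y : 'rV[R]_n | forall i, A i (y 0 i)].
have mA i : measurable (A i) by rewrite /A; case: ifPn.
have mD : measurable D.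
  rewrite (_ : D = \bigcap_(i in [set: 'I_n]) ((fun y => y 0 i) @^-1` A i)).
    apply: fin_bigcap_measurable; first exact: finite_finset.
    move=> i _; rewrite -[X in measurable X]setTI; exact: measurable_coord_rV.
  by apply/seteqP; split=> [y yA i _|y yA i]; [exact: yA|exact: (yA i I)].
have muD : mu D = (\prod_(i < n) (delta / 4)%:E)%E.
  rewrite /D lebesgue_rV_box//; apply: eq_bigr => i _; rewrite /A.
  by case: ifPn => _; rewrite lebesgue_measure_itv/= lte_fin ifT -?EFinB; congr EFin || idtac; lra.
have hA i y : D y -> (delta / 4) * `|g 0 i| <= g 0 i * y 0 i /\ `|y 0 i| < delta.
  move=> /(_ i); rewrite /A; case: ifPn => g0; rewrite /= in_itv/= => /andP[h1 h2].
    rewrite ger0_norm// (mulrC _ (g 0 i)); split; first by rewrite ler_wpM2l// ltW.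
    by rewrite gtr0_norm; lra.
  have {}g0 : g 0 i < 0 by rewrite ltNge.
  rewrite ltr0_norm// ltr0_norm; last by lra.
  by split; [nra|lra].
have hD y : D y -> (delta / 4) ^+ 2 * e * enorm g ^+ 2 <= dotrv g y ^+ 2 * q y.
  move=> Dy.
  have h1 : delta / 4 * \sum_i `|g 0 i| <= dotrv g y.
    by rewrite mulr_sumr; apply: ler_sum => i _; have [] := hA i y Dy.
  have h2 : enorm g <= \sum_i `|g 0 i|.
    have S0 (s : seq 'I_n) : 0 <= \sum_(i <- s) `|g 0 i| by exact: sumr_ge0.
    rewrite -(@ler_pXn2r _ 2)// ?nnegrE ?enorm_ge0// sqr_enorm /dotrv.
    elim: (index_enum _) => [|i s ih]; first by rewrite !big_nil expr0n.
    rewrite !big_cons sqrrD -expr2 -[g 0 i ^+ 2]real_normK ?num_real//.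
    rewrite -addrA lerD2l (le_trans ih)// lerDr mulrn_wge0// mulr_ge0//.
  have h3 : delta / 4 * enorm g <= dotrv g y.
    by apply: le_trans h1; rewrite ler_wpM2l// divr_ge0// ltW.
  have h4 : (delta / 4 * enorm g) ^+ 2 <= dotrv g y ^+ 2.
    have k0 : 0 <= delta / 4 * enorm g by rewrite mulr_ge0 ?enorm_ge0// divr_ge0// ltW.
    by rewrite lerXn2r// nnegrE//; exact: le_trans h3.
  have h5 : e <= q y.
    apply: qe; rewrite ball_rVE// => i /=; rewrite !mxE sub0r add0r in_itv/=.
    by have [_] := hA i y Dy; rewrite ltr_norml.
  rewrite mulrAC -exprMn; apply: ler_pM => //; first exact: sqr_ge0.
  exact: ltW.
have K0 : 0 <= (delta / 4) ^+ 2 * e * enorm g ^+ 2.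
  by apply: mulr_ge0; [apply: mulr_ge0; [exact: sqr_ge0|exact: ltW]|exact: sqr_ge0].
have mdot : measurable_fun setT (fun y => dotrv g y).
  apply: measurable_sum => i; apply: measurable_funM => //; exact: measurable_coord_rV.
have mi : measurable_fun setT (fun y => (dotrv g y ^+ 2 * q y)%:E : \bar R).
  by apply/measurable_EFinP; apply: measurable_funM => //; exact: measurable_funX.
apply: (@le_trans _ _ (\int[mu]_(y in D) (dotrv g y ^+ 2 * q y)%:E)%E); last first.
  by apply: ge0_subset_integral => // y _; rewrite lee_fin mulr_ge0// sqr_ge0.
apply: (@le_trans _ _ (\int[mu]_(y in D) ((delta / 4) ^+ 2 * e * enorm g ^+ 2)%:E)%E).
  rewrite integral_cst// [X in (_ * X)%E]muD.
  rewrite mulrAC EFinM; by apply: lee_wpmul2l => //; rewrite lee_fin.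
apply: ge0_le_integral => //.
exact: measurable_funTS.
Qed.

End second_moment.

Section log_target.
Context {R : realType} {n : nat}.
Variables (pi : 'rV[R]_n -> R) (W : set 'rV[R]_n).
Hypotheses (pi0 : forall x, 0 < pi x) (oW : open W) (hW : C2_on W pi).
Let logpi := fun x => ln (pi x).

Let dln (r : R) : 0 < r -> differentiable (@ln R) r.
Proof. by move=> r0; apply/derivable1_diffP; have [] := is_derive1_ln r0. Qed.

Lemma differentiable_logpi a : W a -> differentiable logpi a.
Proof.
move=> Wa; have [dpi _ _] := hW Wa.
by apply: differentiable_comp => //; exact: dln.
Qed.

Lemma partial_logpi i a : W a -> partial i logpi a = partial i pi a / pi a.
Proof.
move=> Wa; have [dpi _ _] := hW Wa.
rewrite /partial deriveE; last exact: differentiable_logpi.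
rewrite diff_comp//; last exact: dln.
rewrite /= diff1E; last exact: dln.
rewrite derive1E; have [_ ->] := is_derive1_ln (pi0 a).
by rewrite /= -deriveE.
Qed.

Lemma partial_logpi_near i a : W a -> exists2 G, differentiable G a &
  \forall z \near a, partial i logpi z = G z.
Proof.
move=> Wa; exists (fun z => partial i pi z * (pi z)^-1).
  have [dpi dpi2 _] := hW Wa.
  apply: differentiableM; first exact: dpi2.
  by apply: differentiableV => //; rewrite gt_eqF.
have := open_nbhs_nbhs (conj oW Wa); apply: filterS => z Wz.
exact: partial_logpi.
Qed.

End log_target.

Section potential.
Context {R : realType} {n : nat}.
Variables (m : R) (pi : 'rV[R]_n -> R) (W : set 'rV[R]_n).
Variables (D1 D2 R0 : R).
Hypotheses (hm : 0 < m < 1) (pi0 : forall x, 0 < pi x).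
Hypotheses (oW : open W) (RW : [set x | R0 <= enorm x] `<=` W) (hW : C2_on W pi).
Let logpi := fun x => ln (pi x).
Hypotheses (D10 : 0 < D1) (D20 : 0 < D2).
Hypothesis hgrad : forall x, R0 <= enorm x ->
  enorm (gradient logpi x) <= D1 * enorm x `^ (m - 1).
Hypothesis hhess : forall x, R0 <= enorm x ->
  `|hessian logpi x| <= D2 * enorm x `^ (m - 2).

(** For a bounded increment, the second order term of the potential is smaller
    than the square of the first order one, since [m - 2 < 2 * (m - 1)]. *)
Lemma potential_expansion (cq : R) : 0 < cq -> exists H r1 : R,
  [/\ 0 < H, 0 < r1 & forall x y, r1 <= enorm x -> enorm y <= cq ->
   [/\ `|logpi (x + y) - logpi x - dotrv (gradient logpi x) y| <=
         H * enorm x `^ (m - 2),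
       H * enorm x `^ (m - 2) <= 1 &
       `|logpi (x + y) - logpi x| <= 1]].
Proof.
move=> cq0; have /andP[m0 m1] := hm.
set H := (n%:R * cq) ^+ 2 * (D2 * 4) + 1.
set K := n%:R * (D1 * cq) + 1.
have H1 : 0 < H by rewrite ltr_wpDl// mulr_ge0 ?sqr_ge0// mulr_ge0// ltW.
have K1 : 0 < K by rewrite ltr_wpDl// !mulr_ge0// ltW.
have [a a0 ha] := @powR_eventually_small R (m - 2) (2^-1 / H) ltac:(lra) ltac:(by rewrite divr_gt0).
have [b b0 hb] := @powR_eventually_small R (m - 1) (2^-1 / K) ltac:(lra) ltac:(by rewrite divr_gt0).
exists H, (a + b + 2 * cq + 2 * `|R0|); split => //.
  by have := normr_ge0 R0; lra.
move=> x y xr yc.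
have nR0 : 0 <= `|R0| by [].
have x0 : 0 < enorm x by lra.
have xa : enorm x `^ (m - 2) <= 2^-1 / H by apply: ha; lra.
have xb : enorm x `^ (m - 1) <= 2^-1 / K by apply: hb; lra.
have Hx : H * enorm x `^ (m - 2) <= 2^-1 by rewrite mulrC -ler_pdivlMr.
have Kx : K * enorm x `^ (m - 1) <= 2^-1 by rewrite mulrC -ler_pdivlMr.
have half (t : R) : 0 <= t <= 1 -> enorm x / 2 <= enorm (x + t *: y).
  by move=> /andP[t0 t1]; apply: half_enorm_le; [lra|rewrite ger0_norm].
have far (t : R) : 0 <= t <= 1 -> R0 <= enorm (x + t *: y).
  move=> /half h; apply: le_trans (ler_norm _) _; lra.
have yn : `|y| <= cq by exact: le_trans (norm_le_enorm y) yc.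
have T : `|logpi (x + y) - logpi x - dotrv (gradient logpi x) y| <=
    (n%:R * `|y|) ^+ 2 * (D2 * 4 * enorm x `^ (m - 2)).
  apply: taylor_hessian.
  - by move=> t t01; apply: (differentiable_logpi pi0 hW); apply: RW; exact: far.
  - by move=> t i t01; apply: (partial_logpi_near pi0 oW hW); apply: RW; exact: far.
  - move=> t t01; apply: (le_trans (hhess (far t t01))).
    rewrite -mulrA ler_wpM2l ?(ltW D20)//.
    apply: (@le_trans _ _ ((enorm x / 2) `^ (m - 2))).
      by apply: powR_antitone; [lra|exact: half|lra].
    rewrite powRM ?(ltW x0)// mulrC ler_wpM2r ?powR_ge0//.
    rewrite -powR_inv1// -powRrM.
    have -> : (4 : R) = 2 `^ 2%:R by rewrite powR_mulrn//; ring.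
    apply: ler_powR; lra.
have T2 : `|logpi (x + y) - logpi x - dotrv (gradient logpi x) y| <=
    H * enorm x `^ (m - 2).
  apply: (le_trans T); rewrite mulrA ler_wpM2r ?powR_ge0//.
  rewrite /H -[leLHS]addr0; apply: lerD => //.
  rewrite ler_wpM2r//; first by rewrite mulr_ge0// ltW.
  by rewrite lerXn2r// ?nnegrE ?mulr_ge0// ?(ltW cq0)// ler_wpM2l.
split => //; first by lra.
have G : `|dotrv (gradient logpi x) y| <= K * enorm x `^ (m - 1).
  apply: (le_trans (dotrv_le _ _)).
  apply: (@le_trans _ _ (n%:R * ((D1 * enorm x `^ (m - 1)) * cq))).
    rewrite ler_wpM2l// ler_pM ?enorm_ge0//.
    by apply: hgrad; move: (far 0); rewrite scale0r addr0 lexx ler01; exact.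
  rewrite (_ : n%:R * _ = n%:R * (D1 * cq) * enorm x `^ (m - 1)); last by ring.
  by rewrite ler_wpM2r ?powR_ge0// /K lerDl.
rewrite -[X in `|X|](subrK (dotrv (gradient logpi x) y)).
by apply: (le_trans (ler_normD _ _)); lra.
Qed.

End potential.

Section lyapunov.
Context {R : realType} {n : nat}.
Implicit Types (x y : 'rV[R]_n).

(** Truncated from below so that its real powers are monotone; far from the origin
    it is [- ln pi]. *)
Definition potential (pi : 'rV[R]_n -> R) x : R := Num.max 1 (- ln (pi x)).

(** With [p = (2 - m) / m], [u `^ p] decreases on average at a rate bounded below
    when [u] is the potential far from the origin; for [A] large this outweighs the
    unit increase of [tau] at each step. *)
Definition lyapunov (c s A p tau u : R) : R := expR (c * (tau + A * u `^ p) `^ s).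

(** The decrease [l ^+ 2 / 8] comes from the rejections of the move that raises the
    potential, and [H] bounds the errors of the linear approximation. *)
Lemma pair_drift (c s A p tau u l e1 e2 H : R) : 0 < s < 1 -> s * p = 1 -> 0 < A ->
  0 < c -> 512 * (c * A `^ s) <= 1 -> 0 < tau -> 128 * p <= u ->
  `|e1| <= H -> `|e2| <= H -> H <= 1 -> `|l + e1| <= 1 -> `|- l + e2| <= 1 ->
  let L := lyapunov c s A p tau in
  let b := c * A * u `^ (p - 1) * (tau + A * u `^ p) `^ (s - 1) in
  let F D := L (u + D) * Num.min (expR (- D)) 1 + L u * (1 - Num.min (expR (- D)) 1) in
  (F (l + e1) + F (- l + e2) + L u * b * (l ^+ 2 / 8) <= L u * (2 + 3 * b * H)) : Prop.
Proof.
move=> s01 sp A0 c0 cA tau0 pu h1 h2 H1 d1 d2 L b F.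
have b0 : 0 <= b by rewrite /b !mulr_ge0 ?powR_ge0// ltW.
have L0 : 0 < L u by exact: expR_gt0.
have FD D : `|D| <= 1 -> F D <= L u * (1 + b * (D - (Num.max 0 D) ^+ 2 / 2 + D ^+ 2 / 32)).
  move=> D1; have acc := acceptance_le D1.
  have a0 : 0 <= Num.min (expR (- D)) 1 by rewrite le_min expR_ge0 ler01.
  have inc := lyapunov_increment s01 sp A0 c0 cA tau0 pu D1.
  have h := ler_wpM2r a0 inc.
  apply: (@le_trans _ _ (L u * (1 + b * ((D + D ^+ 2 / 32) * Num.min (expR (- D)) 1)))).
    apply: (le_trans (lerD h (lexx _))); rewrite /L /lyapunov -/b le_eqVlt.
    by apply/orP; left; apply/eqP; ring.
  by rewrite ler_wpM2l ?(ltW L0)// lerD2l ler_wpM2l.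
apply: (le_trans (lerD (lerD (FD _ d1) (FD _ d2)) (lexx _))).
have opp := @opposite_moves_le _ l e1 e2 H h1 h2 H1.
rewrite -mulrDr -mulrA -mulrDr ler_wpM2l ?(ltW L0)//.
move: opp; set X1 := (_ + _ / 32); set X2 := (_ + _ / 32) => opp.
have := ler_wpM2l b0 opp; rewrite mulrDr mulrBr.
by rewrite (_ : b * (3 * H) = 3 * b * H); [lra|ring].
Qed.

End lyapunov.

(** * The drift far from the origin *)

Section drift_conclusion.
Context {R : realType}.
Implicit Types (m s p A c d H sigma u r tau : R).

(** The gain [b * theta * r `^ (2 * m - 2)] dominates both the error of the
    expansion and, by the choice of [A], the effect of the time step. *)
Lemma drift_conclusion (m s p A c d0 d1 H sigma u r tau : R) (I S : \bar R) :
  0 < s < 1 -> m * (p - 1) = 2 - 2 * m -> 1 < p ->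
  0 < A -> 0 < c -> 0 < d0 -> 0 < d1 -> 0 < sigma -> 0 < r -> 1 <= tau ->
  A * (sigma * d1 ^+ 2 / 16) * d0 `^ (p - 1) = 8 -> d0 * r `^ m <= u ->
  3 * H * r `^ (- m) <= sigma * d1 ^+ 2 / 16 ->
  let T := tau + 1 + A * u `^ p in
  let g := expR (c * T `^ s) in
  let b := c * A * u `^ (p - 1) * T `^ (s - 1) in
  (0 <= I)%E -> ((sigma * (d1 * r `^ (m - 1)) ^+ 2)%:E <= S)%E ->
  (I + I + (g * b / 8)%:E * S <= (g * (2 + 3 * b * (H * r `^ (m - 2))))%:E)%E ->
  (I + (2 * c * T `^ (s - 1) * g)%:E <= (lyapunov c s A p tau u)%:E)%E.
Proof.
move=> s01 mp p1 A0 c0 d00 d10 sigma0 r0 tau1 AE ur Hr T g b I0 hS hI.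
set theta := sigma * d1 ^+ 2 / 16 in AE Hr.
have g0 : 0 < g by exact: expR_gt0.
have up0 : 0 <= u `^ (p - 1) by exact: powR_ge0.
have Ts0 : 0 <= T `^ (s - 1) by exact: powR_ge0.
have b0 : 0 <= b.
  by rewrite /b; apply: mulr_ge0 => //; apply: mulr_ge0 => //; rewrite mulr_ge0 ?ltW.
set rho := r `^ (2 * m - 2).
have rhoE : (r `^ (m - 1)) ^+ 2 = rho.
  by rewrite -powR_mulrn ?powR_ge0// -powRrM /rho; congr (_ `^ _); ring.
have rho0 : 0 < rho by exact: powR_gt0.
have h1 : 3 * (H * r `^ (m - 2)) <= theta * rho.
  have -> : r `^ (m - 2) = r `^ (- m) * rho.
    by rewrite /rho -powRD; [congr (_ `^ _); ring|rewrite (gt_eqF r0) implybT].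
  by rewrite !mulrA ler_wpM2r// ltW.
have h2 : d0 `^ (p - 1) <= u `^ (p - 1) * rho.
  have rm0 : 0 < d0 * r `^ m by rewrite mulr_gt0// powR_gt0.
  have p10 : 0 <= p - 1 by lra.
  have := powR_monotone (ltW rm0) ur p10.
  rewrite powRM ?powR_ge0 ?(ltW d00)// -powRrM mp => h.
  have rr : r `^ (2 - 2 * m) * rho = 1.
    rewrite /rho -powRD; last by rewrite (gt_eqF r0) implybT.
    by rewrite (_ : 2 - 2 * m + (2 * m - 2) = 0) ?powRr0//; ring.
  by have := ler_wpM2r (ltW rho0) h; rewrite -mulrA rr mulr1.
have h3 : 8 * (c * T `^ (s - 1)) <= b * (theta * rho).
  have theta0 : 0 < theta by rewrite /theta divr_gt0// mulr_gt0// exprn_gt0.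
  have k0 : 0 <= c * A * T `^ (s - 1) * theta.
    by apply: mulr_ge0 (ltW theta0); apply: mulr_ge0 => //; rewrite mulr_ge0 ?ltW.
  have := ler_wpM2l k0 h2.
  have -> : c * A * T `^ (s - 1) * theta * d0 `^ (p - 1) =
    A * theta * d0 `^ (p - 1) * (c * T `^ (s - 1)) by ring.
  rewrite AE; congr (_ <= _); rewrite /b; ring.
have gb0 : 0 <= g * b / 8 by apply: divr_ge0 => //; rewrite mulr_ge0// ltW.
have hI2 : (I + I + (g * b / 8 * (sigma * (d1 * r `^ (m - 1)) ^+ 2))%:E <=
    (g * (2 + 3 * b * (H * r `^ (m - 2))))%:E)%E.
  by apply: le_trans hI; rewrite leeD2l// EFinM lee_wpmul2l// lee_fin.
have T2 : 2 <= T.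
  have Au0 : 0 <= A * u `^ p by rewrite mulr_ge0 ?powR_ge0// ltW.
  by rewrite /T; clear -tau1 Au0; lra.
have step := time_step_le s01 c0 T2.
rewrite (_ : T - 1 = tau + A * u `^ p) in step; last by rewrite /T; ring.
rewrite -/(lyapunov c s A p tau u) -/g in step.
move: hI2; rewrite exprMn rhoE.
have -> : g * b / 8 * (sigma * (d1 ^+ 2 * rho)) = 2 * (g * (b * (theta * rho))).
  by rewrite /theta; clear; field.
have h4 : g * (3 * b * (H * r `^ (m - 2))) <= g * (b * (theta * rho)).
  apply: (ler_wpM2l (ltW g0)).
  by rewrite (mulrC 3 b) -(mulrA b 3); exact: ler_wpM2l.
have h5 := ler_wpM2l (ltW g0) h3.
rewrite mulrDr; case: I I0 {hI} => [i|//|//]; rewrite -!EFinD !lee_fin => i0 hi.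
apply: le_trans step.
move: h4 h5 hi; rewrite mulrBr mulr1.
have -> : g * (8 * (c * T `^ (s - 1))) = 8 * (c * T `^ (s - 1) * g) by ring.
have -> : 2 * c * T `^ (s - 1) * g = 2 * (c * T `^ (s - 1) * g) by ring.
have -> : g * (2 * c * T `^ (s - 1)) = 2 * (c * T `^ (s - 1) * g) by ring.
clear; lra.
Qed.

End drift_conclusion.

Section drift.
Context {R : realType} {n : nat}.
Implicit Types (x y : 'rV[R]_n).
Local Notation mu := (lebesgue_rV R n).

Lemma dotrvN (g y : 'rV[R]_n) : dotrv g (- y) = - dotrv g y.
Proof. by rewrite /dotrv -sumrN; apply: eq_bigr => i _; rewrite mxE mulrN. Qed.

Lemma measurable_potential (pi : 'rV[R]_n -> R) : measurable_fun setT pi ->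
  measurable_fun setT (potential pi).
Proof.
move=> mpi; apply: measurable_maxr => //; apply: measurable_funN.
exact: measurableT_comp (@measurable_ln R) mpi.
Qed.

Lemma measurable_lyapunov (c s A p tau : R) (pi : 'rV[R]_n -> R) :
  measurable_fun setT pi ->
  measurable_fun setT (fun x => lyapunov c s A p tau (potential pi x)).
Proof.
move=> mpi; apply: (@measurableT_comp _ _ _ _ _ _ (@expR R)); first exact: measurable_expR.
apply: measurable_funM => //.
apply: (@measurableT_comp _ _ _ _ _ _ (@powR R ^~ s)); first exact: measurable_powR.
apply: measurable_funD => //; apply: measurable_funM => //.
apply: (@measurableT_comp _ _ _ _ _ _ (@powR R ^~ p)); first exact: measurable_powR.
exact: measurable_potential.
Qed.

Variables (m : R) (pi q : 'rV[R]_n -> R).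
Hypotheses (hm : 0 < m < 1) (hpi : target_assumption m pi).
Hypothesis hq : proposal_assumption q.
Variable P : R.-pker 'rV[R]_n ~> 'rV[R]_n.
Hypothesis hP : is_metropolis_kernel pi q P.

Let s := m / (2 - m).
Let p := (2 - m) / m.

Let cpi : continuous pi. Proof. by case: hpi. Qed.
Let pi0 x : 0 < pi x. Proof. by case: hpi => _ + _; exact. Qed.
Let mpi : measurable_fun setT pi. Proof. exact: continuous_measurable_rV. Qed.
Let q_density : is_density q. Proof. by case: hq. Qed.
Let mq : measurable_fun setT q. Proof. by case: q_density. Qed.
Let q0 y : 0 <= q y. Proof. by case: q_density => _ + _; exact. Qed.
Let qN y : q (- y) = q y. Proof. by case: hq => _ + _ _; exact. Qed.

Let acc x y := acceptance pi x (x + y).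

(** As [q] is even, [y] and [- y] can be paired, which lets the first order
    effects cancel. *)
Lemma metropolis_symmetrized x (g : 'rV[R]_n -> R) : measurable_fun setT g ->
  (forall y, 0 <= g y) ->
  let F y := g (x + y) * acceptance pi x (x + y)
             + g x * (1 - acceptance pi x (x + y)) in
  (\int[P x]_y (g y)%:E + \int[P x]_y (g y)%:E =
   \int[mu]_y ((F y + F (- y)) * q y)%:E)%E.
Proof.
move=> mg g0 F.
have macc := measurable_acceptance mpi pi0 x.
have a0 y : 0 <= acceptance pi x y by exact: acceptance_ge0.
have a1 y : 0 <= 1 - acceptance pi x y by rewrite subr_ge0; exact: acceptance_le1.
have F0 y : 0 <= F y by rewrite addr_ge0// mulr_ge0.
have mF : measurable_fun setT F.
  apply: measurable_funD; apply: measurable_funM => //; last exact: measurable_funB.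
  exact: measurableT_comp mg (measurable_translate_rV x).
have mFN : measurable_fun setT (fun y => F (- y)).
  exact: measurableT_comp mF measurable_oppr_rV.
have E1 : (\int[P x]_y (g y)%:E = \int[mu]_y (F y * q y)%:E)%E.
  rewrite (metropolis_integralE mpi pi0 q_density hP)//; last exact/measurable_EFinP.
  rewrite -ge0_integralZl//; last 3 first.
  - by apply/measurable_EFinP; apply: measurable_funM => //; exact: measurable_funB.
  - by move=> y _; rewrite lee_fin mulr_ge0.
  - by rewrite lee_fin.
  rewrite -ge0_integralD//; last 4 first.
  - by move=> y _; rewrite mule_ge0// lee_fin// mulr_ge0.
  - apply: emeasurable_funM; apply/measurable_EFinP.
      exact: measurableT_comp mg (measurable_translate_rV x).
    exact: measurable_funM.
  - by move=> y _; rewrite mule_ge0// lee_fin// mulr_ge0.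
  - apply: measurable_funeM; apply/measurable_EFinP; apply: measurable_funM => //.
    exact: measurable_funB.
  apply: eq_integral => y _; rewrite -!EFinM -EFinD /F; congr EFin; ring.
have E2 : (\int[mu]_y (F y * q y)%:E = \int[mu]_y (F (- y) * q y)%:E)%E.
  rewrite -[LHS]ge0_integral_opp_rV//; last 2 first.
  - by apply/measurable_EFinP; exact: measurable_funM.
  - by move=> y; rewrite lee_fin mulr_ge0.
  by apply: eq_integral => y _; rewrite qN.
rewrite E1 [X in (_ + X)%E]E2 -ge0_integralD//; last 4 first.
- by move=> y _; rewrite lee_fin mulr_ge0.
- by apply/measurable_EFinP; exact: measurable_funM.
- by move=> y _; rewrite lee_fin mulr_ge0.
- by apply/measurable_EFinP; exact: measurable_funM.
by apply: eq_integral => y _; rewrite -EFinD -mulrDl.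
Qed.

Lemma metropolis_pair_le (g : 'rV[R]_n -> R) (v : 'rV[R]_n) (k K cq : R) x :
  measurable_fun setT g -> (forall y, 0 <= g y) -> 0 <= k -> 0 <= K ->
  (forall y, cq < enorm y -> q y = 0) ->
  let F y := g (x + y) * acceptance pi x (x + y)
             + g x * (1 - acceptance pi x (x + y)) in
  (forall y, enorm y <= cq -> F y + F (- y) + k * dotrv v y ^+ 2 <= K) ->
  (\int[P x]_y (g y)%:E + \int[P x]_y (g y)%:E +
     k%:E * \int[mu]_y (dotrv v y ^+ 2 * q y)%:E <= K%:E)%E.
Proof.
move=> mg g0 k0 K0 hcq F key.
have F0 y : 0 <= F y.
  apply: addr_ge0; apply: mulr_ge0; [exact: g0|exact: acceptance_ge0|exact: g0|].
  by rewrite subr_ge0; exact: acceptance_le1.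
have macc := measurable_acceptance mpi pi0 x.
have mF : measurable_fun setT F.
  apply: measurable_funD; apply: measurable_funM => //; last exact: measurable_funB.
  exact: measurableT_comp mg (measurable_translate_rV x).
have mFN : measurable_fun setT (fun y => F (- y)).
  exact: measurableT_comp mF measurable_oppr_rV.
have mdot : measurable_fun setT (fun y => dotrv v y).
  by apply: measurable_sum => i; apply: measurable_funM => //; exact: measurable_coord_rV.
have m2 : measurable_fun setT (fun y => dotrv v y ^+ 2 * q y).
  by apply: measurable_funM => //; exact: measurable_funX.
have v0 y : 0 <= dotrv v y ^+ 2 * q y by rewrite mulr_ge0// sqr_ge0.
have FF0 y : 0 <= (F y + F (- y)) * q y by rewrite mulr_ge0// addr_ge0.
have mFF : measurable_fun setT (fun y => (F y + F (- y)) * q y).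
  by apply: measurable_funM => //; exact: measurable_funD.
have -> : (\int[P x]_y (g y)%:E + \int[P x]_y (g y)%:E =
  \int[mu]_y ((F y + F (- y)) * q y)%:E)%E by exact: metropolis_symmetrized.
rewrite -ge0_integralZl//; last 2 first.
- exact/measurable_EFinP.
- by move=> y _; rewrite lee_fin.
rewrite -ge0_integralD//; last 4 first.
- by move=> y _; rewrite lee_fin.
- exact/measurable_EFinP.
- by move=> y _; rewrite mule_ge0// lee_fin.
- by apply: measurable_funeM; exact/measurable_EFinP.
have q1 : (\int[mu]_y (q y)%:E = 1)%E by case: q_density.
apply: (@le_trans _ _ (\int[mu]_y (K%:E * (q y)%:E))%E); last first.
  rewrite ge0_integralZl//; [|exact/measurable_EFinP|by move=> y _; rewrite lee_fin].
  by rewrite q1 mule1.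
apply: ge0_le_integral => //.
- by move=> y _; rewrite adde_ge0 ?mule_ge0// lee_fin.
- apply: emeasurable_funD; first exact/measurable_EFinP.
  by apply: measurable_funeM; exact/measurable_EFinP.
- by apply: measurable_funeM; exact/measurable_EFinP.
move=> y _; rewrite -!EFinM -EFinD lee_fin.
have [yc|/hcq ->] := leP (enorm y) cq; last by rewrite !mulr0 addr0.
by rewrite mulrA -mulrDl ler_wpM2r// key.
Qed.

Lemma drift_step (A c tau u H cq : R) x : 0 < s < 1 -> s * p = 1 ->
  0 < A -> 0 < c -> 512 * (c * A `^ s) <= 1 -> 0 < tau -> 128 * p <= u ->
  potential pi x = u -> - ln (pi x) = u ->
  (forall y, cq < enorm y -> q y = 0) ->
  (forall y, enorm y <= cq -> potential pi (x + y) = - ln (pi (x + y))) ->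
  let grad := gradient (fun y => ln (pi y)) x in
  0 <= cq -> (forall y, enorm y <= cq ->
    [/\ `|ln (pi (x + y)) - ln (pi x) - dotrv grad y| <= H, H <= 1 &
        `|ln (pi (x + y)) - ln (pi x)| <= 1]) ->
  let T := tau + A * u `^ p in
  let g := expR (c * T `^ s) in
  let b := c * A * u `^ (p - 1) * T `^ (s - 1) in
  let I := (\int[P x]_y (lyapunov c s A p tau (potential pi y))%:E)%E in
  ((I + I + (g * b / 8)%:E * \int[mu]_y (dotrv grad y ^+ 2 * q y)%:E <=
    (g * (2 + 3 * b * H))%:E)%E : Prop).
Proof.
move=> s01 sp A0 c0 cA tau0 pu ux uE hcq far grad cq0 hexp T g b I.
have g0 : 0 < g by exact: expR_gt0.
have b0 : 0 <= b.
  by apply: mulr_ge0 (powR_ge0 _ _); apply: mulr_ge0 (powR_ge0 _ _); rewrite mulr_ge0 ?ltW.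
pose Gn y := lyapunov c s A p tau (potential pi y).
have mGn : measurable_fun setT Gn by exact: measurable_lyapunov.
have Gn0 y : 0 <= Gn y by exact: expR_ge0.
pose F y := Gn (x + y) * acceptance pi x (x + y)
            + Gn x * (1 - acceptance pi x (x + y)).
pose D y := - (ln (pi (x + y)) - ln (pi x)).
have key y : enorm y <= cq ->
    F y + F (- y) + g * b * (dotrv grad y ^+ 2 / 8) <= g * (2 + 3 * b * H).
  move=> yc.
  have yNc : enorm (- y) <= cq by rewrite enormN.
  have FE z : enorm z <= cq -> F z =
      lyapunov c s A p tau (u + D z) * Num.min (expR (- D z)) 1
      + lyapunov c s A p tau u * (1 - Num.min (expR (- D z)) 1).
    move=> zc; rewrite /F /Gn ux acceptanceE// far//.
    have -> : pi (x + z) / pi x = expR (- D z).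
      by rewrite /D opprK expRD expRN !lnK ?posrE.
    by rewrite (_ : u + D z = - ln (pi (x + z)))// /D -uE; ring.
  have [hy hH1 hD] := hexp y yc.
  have [hyN _ hDN] := hexp (- y) yNc.
  have e1 : - dotrv grad y + (D y + dotrv grad y) = D y by ring.
  have e2 : - - dotrv grad y + (D (- y) - dotrv grad y) = D (- y) by ring.
  have := @pair_drift _ c s A p tau u (- dotrv grad y)
    (D y + dotrv grad y) (D (- y) - dotrv grad y) H s01 sp A0 c0 cA tau0 pu.
  cbv zeta; rewrite e1 e2 sqrrN (FE y)// (FE (- y))//.
  apply => //.
  - rewrite -normrN (_ : - _ = ln (pi (x + y)) - ln (pi x) - dotrv grad y)//.
    by rewrite /D; ring.
  - have -> : D (- y) - dotrv grad y =
        - (ln (pi (x + - y)) - ln (pi x) - dotrv grad (- y)).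
      by rewrite dotrvN /D; ring.
    by rewrite normrN.
  - by rewrite /D normrN.
  - by rewrite /D normrN.
have z0 : enorm (0 : 'rV[R]_n) <= cq.
  by rewrite /enorm /dotrv big1 ?sqrtr0// => i _; rewrite mxE mul0r.
have [_ H0 _] := hexp 0 z0.
have {}H0 : 0 <= H by have [h _ _] := hexp 0 z0; exact: le_trans h.
have k0 : 0 <= g * b / 8.
  by apply: divr_ge0 => //; apply: mulr_ge0 => //; exact: ltW.
have K0 : 0 <= g * (2 + 3 * b * H).
  apply: mulr_ge0; first exact: ltW.
  by apply: addr_ge0 => //; apply: mulr_ge0 => //; exact: mulr_ge0.
apply: (@metropolis_pair_le Gn grad _ _ cq x mGn Gn0 k0 K0 hcq) => y /key.
by rewrite (_ : g * b / 8 * _ = g * b * (dotrv grad y ^+ 2 / 8))//; ring.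
Qed.

(** The half of the decrease that remains after paying for the time step. *)
Lemma metropolis_drift : exists A c rad : R, [/\ 0 < A, 0 < c &
  forall tau x, 1 <= tau -> rad <= enorm x ->
  let T := tau + 1 + A * potential pi x `^ p in
  ((\int[P x]_y (lyapunov c s A p (tau + 1) (potential pi y))%:E +
    (2 * c * T `^ (s - 1) * expR (c * T `^ s))%:E <=
    (lyapunov c s A p tau (potential pi x))%:E)%E : Prop)].
Proof.
have /andP[m0 m1] := hm.
have double (a b : R) : 0 < b -> 2 * a <= b -> a <= b by lra.
have halved (a b h : R) : 2 * a <= b -> b / 2 <= h -> a <= h by lra.
have split_rad (a1 a2 a3 a4 a5 a6 e : R) : 0 < a1 -> 0 < a2 -> 0 < a3 -> 0 < a4 ->
    0 <= a5 -> a6 <= a5 -> a1 + 2 * a2 + a3 + 2 * a4 + 2 * a5 <= e ->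
    [/\ a1 <= e, 2 * a2 <= e, a3 <= e, 2 * a4 <= e & 2 * a6 <= e].
  by move=> *; split; lra.
have times128 (a : R) : 1 < a -> 1 <= 128 * a by lra.
have succ0 (a : R) : 1 <= a -> 0 < a + 1 by lra.
have s01 : 0 < s < 1.
  by rewrite /s divr_gt0//=; [rewrite ltr_pdivrMr; lra|lra].
have sp : s * p = 1 by rewrite /s /p; field; rewrite !gt_eqF//; lra.
have p1 : 1 < p by rewrite /p ltr_pdivlMr//; lra.
have mp : m * (p - 1) = 2 - 2 * m by rewrite /p; field; rewrite gt_eqF.
have [_ _ [r0 [d0 [D0 [d1 [D1 [d2 [D2 [R0]]]]]]]]] := hpi.
move=> [_ [[d00 D00] [d10 D10] [d20 D20]] [W [oW RW] hW] hb].
have [_ _ [e e0 /nbhs_ballP[delta /= delta0 qe]] [cq0 hcq]] := hq.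
set cq := `|cq0| + 1.
have cqpos : 0 < cq by rewrite /cq ltr_wpDl.
have hcq' y : cq < enorm y -> q y = 0.
  by move=> h; apply: hcq; rewrite (le_trans _ (ltW h))// /cq (le_trans (ler_norm _))// lerDl.
have hgrad x : R0 <= enorm x -> enorm (gradient (fun y => ln (pi y)) x) <= D1 * enorm x `^ (m - 1).
  by move=> /hb[_ _ /andP[]].
have hhess x : R0 <= enorm x -> `|hessian (fun y => ln (pi y)) x| <= D2 * enorm x `^ (m - 2).
  by move=> /hb[_ _ _ /andP[]].
have [H [r1 [H0 r10 hexp]]] :=
  potential_expansion hm pi0 oW RW hW D10 D20 hgrad hhess cqpos.
have [sigma sigma0 hsigma] := second_moment_ge mq q0 e0 delta0 qe.
set theta := sigma * d1 ^+ 2 / 16.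
have theta0 : 0 < theta by rewrite /theta divr_gt0// mulr_gt0// exprn_gt0.
(* [A] makes the decrease of the Lyapunov function twice the cost of the time step;
   [c] then makes the slope condition of [lyapunov_increment] an equality. *)
pose A := 8 / (theta * d0 `^ (p - 1)).
have dp0 : 0 < d0 `^ (p - 1) by exact: powR_gt0.
have A0 : 0 < A by rewrite /A divr_gt0// mulr_gt0.
have AE : A * theta * d0 `^ (p - 1) = 8.
  by rewrite -mulrA /A divfK// gt_eqF// mulr_gt0.
have As0 : 0 < A `^ s by exact: powR_gt0.
have k0 : 0 < 512^-1 :> R by lra.
pose c := 512^-1 / A `^ s.
have c0 : 0 < c by exact: divr_gt0 k0 As0.
have cA : 512 * (c * A `^ s) <= 1.
  have -> : c * A `^ s = 512^-1 by rewrite /c divfK// gt_eqF.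
  by lra.
have [ra ra0 hra] := @powR_eventually_large R m (128 * p / d0) m0.
have [rb rb0 hrb] : exists2 rb, 0 < rb & forall r, rb <= r -> r `^ (- m) <= theta / (3 * H).
  apply: powR_eventually_small; first by rewrite oppr_lt0.
  by apply: divr_gt0 => //; exact: mulr_gt0.
have large x : ra <= enorm x -> R0 <= enorm x -> 128 * p <= - ln (pi x).
  move=> /hra h /hb[_ /andP[h' _] _ _]; apply: le_trans h'.
  by rewrite [leRHS]mulrC -ler_pdivrMr.
have p128 := times128 p p1.
have U1 x : ra <= enorm x -> R0 <= enorm x -> potential pi x = - ln (pi x).
  move=> h1 h2; rewrite /potential max_r//.
  exact: le_trans p128 (large x h1 h2).
exists A, c, (r1 + 2 * ra + rb + 2 * cq + 2 * `|R0|); split => // tau x tau1 xrad; cbv zeta.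
have [xr1 xra xrb xcq xR0] : [/\ r1 <= enorm x, 2 * ra <= enorm x, rb <= enorm x,
   2 * cq <= enorm x & 2 * R0 <= enorm x].
  exact: (split_rad r1 ra rb cq `|R0| R0) (ler_norm _) xrad.
have x0 : 0 < enorm x by exact: lt_le_trans xr1.
have xra' : ra <= enorm x by exact: double.
have xR0' : R0 <= enorm x by exact: double.
have ux : potential pi x = - ln (pi x) by exact: U1.
have hu := large x xra' xR0'.
have tau0 : 0 < tau + 1 by exact: succ0.
have far y : enorm y <= cq -> potential pi (x + y) = - ln (pi (x + y)).
  move=> yc; have : enorm x / 2 <= enorm (x + y).
    have y2 : 2 * enorm y <= enorm x by apply: le_trans xcq; rewrite ler_pM2l.
    by rewrite -[y]scale1r; apply: half_enorm_le; [|rewrite normr1].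
  by move=> h; apply: U1; exact: halved h.
rewrite ux.
have [_ /andP[hd0 _] /andP[hd1 _] _] := hb x xR0'.
apply: (drift_conclusion (m := m) (d0 := d0) (d1 := d1) (H := H) (sigma := sigma)
  (r := enorm x) (S := \int[mu]_y (dotrv (gradient (fun y => ln (pi y)) x) y ^+ 2 * q y)%:E)) => //.
- have H3 : 0 < 3 * H by exact: mulr_gt0.
  by have := hrb _ xrb; rewrite ler_pdivlMr// mulrC.
- by apply: integral_ge0 => y _; rewrite lee_fin expR_ge0.
- apply: le_trans (hsigma _); rewrite lee_fin ler_pM2l// lerXn2r// nnegrE ?enorm_ge0//.
  by rewrite mulr_ge0 ?powR_ge0// ltW.
- apply: (@drift_step A c (tau + 1) (- ln (pi x)) (H * enorm x `^ (m - 2)) cq x) => //.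
  + exact: ltW.
  + by move=> y yc; have [? ? ?] := hexp x y xr1 yc.
Qed.

End drift.

(** * Rates and weights *)

Section time_weights.
Context {R : realType}.
Implicit Types (s c K M A p tau u : R).

(** The weight [eta * expR (c * tau `^ s)] grows slowly enough for its increments
    to be absorbed by the drift, and being subexponential it dominates the loss
    [expR (c * (tau + K) `^ s) - expR (c * tau `^ s)] at late times. *)
Lemma time_weights s c K M : 0 < s < 1 -> 0 < c -> 1 <= K -> 0 <= M ->
  exists eta tau0, [/\ 0 < eta, 1 <= tau0 & forall tau, tau0 <= tau ->
   [/\ 1 - s <= c / 2 * s * tau `^ s,
       forall t, 0 <= t <= M ->
         eta * (expR (c * (tau + 1) `^ s) - expR (c * tau `^ s)) * t <=
         c * (tau + 1) `^ (s - 1) * expR (c * (tau + 1) `^ s) &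
       forall t, 0 <= t <= M ->
         expR (c * (tau + K) `^ s) +
         eta * (expR (c * (tau + 1) `^ s) - expR (c * tau `^ s)) * t +
         eta / 2 * expR (c * tau `^ s) <= (1 + eta) * expR (c * tau `^ s)]].
Proof.
move=> s01 c0 K1 M0; have /andP[s0 s1] := s01.
have K0 : 0 < K by lra.
(* This [eta] ensures [eta * t <= 1 / 2] for [t <= M]. *)
set eta := (2 * M + 2)^-1.
have eta0 : 0 < eta by rewrite /eta invr_gt0; lra.
have etaM : eta * M <= 2^-1.
  by rewrite /eta mulrC ler_pdivrMr; lra.
have l0 : 0 < ln (1 + eta / 4) by rewrite ln_gt0// ltrDl divr_gt0.
have [a a0 ha] := @powR_eventually_small R (s - 1) (ln (1 + eta / 4) / (c * K))
  ltac:(lra) ltac:(by rewrite divr_gt0// mulr_gt0).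
have [b b0 hb] := @powR_eventually_large R s ((1 - s) / (c / 2 * s)) s0.
exists eta, (1 + a + b); split => //; first by lra.
move=> tau tau1.
have tau0 : 0 < tau by lra.
set g := expR (c * tau `^ s); set g1 := expR (c * (tau + 1) `^ s).
have g0 : 0 < g by exact: expR_gt0.
have gg1 : g <= g1.
  by rewrite ler_expR ler_pM2l// powR_monotone; lra.
have step : g1 - g <= 2 * c * (tau + 1) `^ (s - 1) * g1.
  have := @time_step_le _ s c (tau + 1) s01 c0 ltac:(lra).
  rewrite addrK -/g1 -/g mulrBr mulr1; lra.
have gK : expR (c * (tau + K) `^ s) <= (1 + eta / 4) * g.
  have t1 := @powR_le_tangent _ s tau (tau + K) s01 tau0 ltac:(lra).
  have ht : tau `^ (s - 1) <= ln (1 + eta / 4) / (c * K) by apply: ha; lra.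
  have h2 : c * (K * tau `^ (s - 1)) <= ln (1 + eta / 4).
    by move: ht; rewrite ler_pdivlMr ?mulr_gt0// mulrA mulrC.
  have h3 : s * (K * tau `^ (s - 1)) <= 1 * (K * tau `^ (s - 1)).
    by rewrite ler_wpM2r ?mulr_ge0 ?powR_ge0// ltW.
  have h4 : c * (tau + K) `^ s <= c * tau `^ s + c * (K * tau `^ (s - 1)).
    rewrite -mulrDr ler_pM2l//; move: t1 h3.
    rewrite (_ : tau + K - tau = K); last by ring.
    rewrite (_ : s * tau `^ (s - 1) * K = s * (K * tau `^ (s - 1))); last by ring.
    lra.
  have -> : (1 + eta / 4) * g = expR (c * tau `^ s + ln (1 + eta / 4)).
    rewrite expRD lnK; first by rewrite mulrC.
    by rewrite posrE; lra.
  rewrite ler_expR; lra.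
have g1K : g1 <= (1 + eta / 4) * g.
  by apply: le_trans gK; rewrite ler_expR ler_pM2l// powR_monotone; lra.
have gg0 : 0 <= g1 - g by rewrite subr_ge0.
split.
- have := hb tau ltac:(lra); rewrite ler_pdivrMr ?mulr_gt0 ?divr_gt0//.
  by rewrite [leRHS]mulrC.
- move=> t /andP[t0 tM].
  have h : eta * t <= 2^-1 by rewrite (le_trans _ etaM)// ler_pM2l.
  have et0 : 0 <= eta * t by rewrite mulr_ge0// ltW.
  have h2 : (eta * t) * (g1 - g) <= 2^-1 * (2 * c * (tau + 1) `^ (s - 1) * g1).
    by apply: (ler_pM et0 gg0 h step).
  rewrite mulrAC; apply: (le_trans h2); rewrite le_eqVlt; apply/orP; left.
  by apply/eqP; field.
- move=> t /andP[t0 tM].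
  have h : eta * t <= 2^-1 by rewrite (le_trans _ etaM)// ler_pM2l.
  have et0 : 0 <= eta * t by rewrite mulr_ge0// ltW.
  have h2 : (eta * t) * (g1 - g) <= 2^-1 * (eta / 4 * g).
    by apply: (ler_pM et0 gg0 h); rewrite lerBlDl -[X in X + _]mul1r -mulrDl.
  rewrite [eta * _ * t]mulrAC.
  have eg0 : 0 < eta * g by rewrite mulr_gt0.
  move: h2 gK; rewrite !mulrDl mul1r (mulrAC eta 4^-1) (mulrAC eta 2^-1).
  by move: eg0; clear; lra.
Qed.

(** Half of the exponent pays for the factor [T `^ (s - 1)]; the other half is
    split between time and position. *)
Lemma gain_le s p c A tau0 tau u : 0 < s < 1 -> s * p = 1 -> 0 < c -> 0 < A ->
  1 <= tau0 -> tau0 <= tau -> 0 <= u -> 1 - s <= c / 2 * s * tau0 `^ s ->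
  let T := tau + 1 + A * u `^ p in
  (c * tau0 `^ (s - 1) * (expR (c / 4 * tau `^ s) * expR (c / 4 * A `^ s * u)) <=
  c * T `^ (s - 1) * expR (c * T `^ s) : Prop).
Proof.
move=> s01 sp c0 A0 tau01 tau0tau u0 h T; have /andP[s0 s1] := s01.
have Au0 : 0 <= A * u `^ p by rewrite mulr_ge0 ?powR_ge0// ltW.
have T0 : tau0 <= T by rewrite /T; lra.
have tauT : tau <= T by rewrite /T; lra.
have AuT : A * u `^ p <= T by rewrite /T; lra.
have tau_ge0 : 0 <= tau by lra.
have mono := @powR_expR_monotone _ s (c / 2) tau0 T s01 ltac:(lra) T0 h.
have e1 : 1 <= expR (c / 2 * tau0 `^ s).
  by rewrite -expR0 ler_expR mulr_ge0 ?powR_ge0// divr_ge0// ltW.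
have h1 : tau0 `^ (s - 1) <= T `^ (s - 1) * expR (c / 2 * T `^ s).
  by apply: le_trans mono; rewrite ler_peMr ?powR_ge0.
have Tt : tau `^ s <= T `^ s by exact: powR_monotone tauT (ltW s0).
have Tu : A `^ s * u <= T `^ s.
  have <- : (A * u `^ p) `^ s = A `^ s * u.
    by rewrite powRM ?powR_ge0 ?(ltW A0)// -powRrM [p * s]mulrC sp powRr1.
  exact: powR_monotone AuT (ltW s0).
have h2 : expR (c / 4 * tau `^ s) * expR (c / 4 * A `^ s * u) <= expR (c / 2 * T `^ s).
  rewrite -expRD ler_expR -(mulrA (c / 4)) -mulrDr.
  rewrite (_ : c / 2 = c / 4 * 2); last by field.
  have c4 : 0 < c / 4 by rewrite divr_gt0.
  by rewrite -(mulrA (c / 4) 2) ler_pM2l//; lra.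
have -> : c * T `^ s = c / 2 * T `^ s + c / 2 * T `^ s by field.
rewrite expRD -[leLHS]mulrA -[leRHS]mulrA ler_pM2l// [leRHS]mulrA.
by apply: (ler_pM (powR_ge0 _ _) (mulr_ge0 (expR_ge0 _) (expR_ge0 _)) h1 h2).
Qed.

(** From [a + b <= 2 * max a b]; it links the initial value of the supersolution to
    a power of [pi]. *)
Lemma lyapunov0_le s p c A tau u : 0 < s < 1 -> s * p = 1 -> 0 < c -> 0 < A ->
  0 < tau -> 0 <= u ->
  lyapunov c s A p tau u <= expR (2 * c * tau `^ s) * expR (2 * c * A `^ s * u).
Proof.
move=> /andP[s0 s1] sp c0 A0 tau0 u0; rewrite /lyapunov -expRD ler_expR.
have -> : 2 * c * tau `^ s + 2 * c * A `^ s * u = c * (2 * (tau `^ s + A `^ s * u)).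
  by ring.
rewrite ler_pM2l//.
have E : (A * u `^ p) `^ s = A `^ s * u.
  by rewrite powRM ?powR_ge0 ?(ltW A0)// -powRrM [p * s]mulrC sp powRr1.
have Au0 : 0 <= A * u `^ p by rewrite mulr_ge0 ?powR_ge0// ltW.
have two v : 0 <= v -> (2 * v) `^ s <= 2 * v `^ s.
  move=> v0; rewrite powRM// ler_wpM2r ?powR_ge0//.
  by rewrite -[leRHS]powRr1//; apply: ler_powR; lra.
have t0 := powR_ge0 tau s; have a0 := powR_ge0 (A * u `^ p) s.
rewrite -E; have [h|h] := leP tau (A * u `^ p).
- have := powR_monotone (a := tau + A * u `^ p) (b := 2 * (A * u `^ p)) ltac:(lra) ltac:(lra) (ltW s0).
  by have := two _ Au0; lra.
- have := powR_monotone (a := tau + A * u `^ p) (b := 2 * tau) ltac:(lra) ltac:(lra) (ltW s0).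
  by have := two _ (ltW tau0); lra.
Qed.

End time_weights.

(** * Regularity *)

Section combination.
Context {R : realType}.

(** Far from the origin, the drift pays for the gain and for the growth of the
    weight of the visits. *)
Lemma weighted_step_far (gain G I D L L1 t : R) :
  I + D <= G -> gain <= D / 2 -> (L1 - L) * t <= D / 2 ->
  gain + (I + L1 * t) <= G + L * t.
Proof. by move=> ? ?; rewrite mulrBl; lra. Qed.

(** At a visit to the central set, the expected number of remaining visits
    decreases by one. *)
Lemma weighted_step_near (gain G I E eta g g1 t : R) :
  I <= E -> g <= G -> gain <= eta / 2 * g ->
  E + eta * (g1 - g) * t + eta / 2 * g <= (1 + eta) * g ->
  gain + (I + eta * g1 * t) <= G + eta * g * (1 + t).
Proof.
move=> h1 h2 h3.
have -> : eta * g * (1 + t) = eta * g + eta * g * t by ring.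
have -> : eta * (g1 - g) * t = eta * g1 * t - eta * g * t by ring.
have -> : (1 + eta) * g = g + eta * g by ring.
lra.
Qed.

Lemma gain_near_le (omega eta c a v u um : R) : 0 <= c -> 0 <= eta -> 0 <= a ->
  0 <= v -> u <= um -> omega <= eta / 2 * expR (- (a * um)) ->
  omega * (expR (c / 4 * v) * expR (a * u)) <= eta / 2 * expR (c * v).
Proof.
move=> c0 eta0 a0 v0 uum ho.
have e0 : 0 <= expR (c / 4 * v) * expR (a * u) by rewrite -expRD expR_ge0.
apply: (le_trans (ler_wpM2r e0 ho)).
rewrite -(mulrA (eta / 2)); apply: ler_wpM2l; first by rewrite divr_ge0.
rewrite -!expRD ler_expR.
have := ler_wpM2l a0 uum; have := mulr_ge0 c0 v0.
rewrite (_ : c / 4 * v = c * v / 4); [lra|ring].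
Qed.

Lemma potential_ge1 n (pi : 'rV[R]_n -> R) x : 1 <= potential pi x.
Proof. by rewrite le_max lexx. Qed.

Lemma measurable_expR_potential n (pi : 'rV[R]_n -> R) (k : R) :
  measurable_fun setT pi -> measurable_fun setT (fun x => expR (k * potential pi x)).
Proof.
move=> mpi; apply: (@measurableT_comp _ _ _ _ _ _ (@expR R)); first exact: measurable_expR.
by apply: measurable_funM => //; exact: measurable_potential.
Qed.

Lemma measurable_powR_comp d (T : measurableType d) (f : T -> R) (r : R) :
  measurable_fun setT f -> measurable_fun setT (fun x => f x `^ r).
Proof.
by move=> mf; apply: (@measurableT_comp _ _ _ _ _ _ (@powR R ^~ r)).
Qed.

Lemma powRN_expR (a z : R) : 0 < a -> a `^ (- z) = expR (z * - ln a).
Proof. by move=> a0; rewrite /powR gt_eqF// mulNr mulrN. Qed.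

Lemma powRN_le_expR_potential n (pi : 'rV[R]_n -> R) x z : 0 < pi x -> 0 <= z ->
  pi x `^ (- z) <= expR (z * potential pi x).
Proof.
move=> pi0 z0; rewrite powRN_expR// ler_expR ler_wpM2l//.
by rewrite /potential le_max lexx orbT.
Qed.

Lemma expR_potential_le n (pi : 'rV[R]_n -> R) x z : 0 < pi x ->
  expR (z * potential pi x) <= expR z + pi x `^ (- z).
Proof.
move=> pi0; rewrite powRN_expR// /potential.
have [_|_] := leP 1 (- ln (pi x)).
  by rewrite lerDr expR_ge0.
by rewrite mulr1 lerDl expR_ge0.
Qed.

End combination.

Lemma metropolis_integral_le (R : realType) n (m : R) (pi q g : 'rV[R]_n -> R)
    (P : R.-pker 'rV[R]_n ~> 'rV[R]_n) (cq E : R) x :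
  target_assumption m pi -> proposal_assumption q -> is_metropolis_kernel pi q P ->
  measurable_fun setT g -> (forall y, 0 <= g y) -> 0 <= E ->
  (forall y, cq < enorm y -> q y = 0) -> g x <= E ->
  (forall y, enorm y <= cq -> g (x + y) <= E) ->
  (\int[P x]_y (g y)%:E <= E%:E)%E.
Proof.
move=> hpi hq hP mg g0 E0 hcq gx gxy; have [_ pi0 _] := hpi.
have conv a y : 0 <= a <= 1 -> enorm y <= cq -> g (x + y) * a + g x * (1 - a) <= E.
  move=> /andP[a0 a1] /gxy h; have a1' : 0 <= 1 - a by rewrite subr_ge0.
  apply: (le_trans (lerD (ler_wpM2r a0 h) (ler_wpM2r a1' gx))).
  by rewrite -mulrDr addrC subrK mulr1.
have acc y z : 0 <= acceptance pi y z <= 1 by rewrite acceptance_ge0// acceptance_le1.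
have EE0 : 0 <= E + E by rewrite addr_ge0.
have key y : enorm y <= cq ->
    g (x + y) * acceptance pi x (x + y) + g x * (1 - acceptance pi x (x + y)) +
    (g (x + - y) * acceptance pi x (x + - y) + g x * (1 - acceptance pi x (x + - y))) +
    0 * dotrv 0 y ^+ 2 <= E + E.
  by move=> yc; rewrite mul0r addr0; apply: lerD; apply: conv => //; rewrite enormN.
have := metropolis_pair_le hpi hq hP mg g0 (lexx 0) EE0 hcq key.
rewrite mul0e adde0; case: (\int[P x]_y (g y)%:E)%E => [i|//|_]; last exact: leNye.
by rewrite -EFinD !lee_fin; lra.
Qed.

Theorem corollary3p2 (R : realType) (d : nat) (m : R) (hm : 0 < m < 1)
    (pi q : 'rV[R]_d -> R) (hpi_density : is_density pi)
    (hpi : target_assumption m pi) (hq : proposal_assumption q)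
    (P : R.-pker 'rV[R]_d ~> 'rV[R]_d) (hP : is_metropolis_kernel pi q P) :
  exists zstar c z : R, [/\ 0 < zstar, 0 < c, 0 < z &
    forall lambda : probability 'rV[R]_d R,
      (\int[lambda]_x (pi x `^ (- zstar))%:E < +oo)%E ->
      regular P (fun x => pi x `^ (- z))
        (fun k => expR (c * k%:R `^ (m / (2 - m)))) lambda].
Proof.
have [A [c [rad [A0 c0 drift]]]] := metropolis_drift hm hpi hq hP.
have /andP[m0 m1] := hm.
move: drift; set s := m / (2 - m); set p := (2 - m) / m => drift.
have s01 : 0 < s < 1.
  by rewrite /s divr_gt0//=; [rewrite ltr_pdivrMr; lra|lra].
have /andP[s0 s1] := s01.
have sp : s * p = 1 by rewrite /s /p; field; rewrite !gt_eqF//; lra.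
have p0 : 0 < p by rewrite -(pmulr_rgt0 _ s0) sp.
clear m0 m1; move: s p s01 s0 s1 sp p0 drift => s p s01 s0 s1 sp p0 drift.
have As0 : 0 < A `^ s by exact: powR_gt0.
have [cpi pi0 _] := hpi.
have mpi : measurable_fun setT pi by exact: continuous_measurable_rV.
have [q_density _ [e e0 /nbhs_ballP[delta /= delta0 qe]] [cq0 hcq]] := hq.
have k40 : 0 < c / 4 by rewrite divr_gt0.
exists (2 * c * A `^ s), (c / 4), (c / 4 * A `^ s); split.
- by rewrite mulr_gt0// mulr_gt0.
- by [].
- by rewrite mulr_gt0.
move=> lambda lambdaV psi [irr _] B mB psiB dO Omega Pr Phi chain.
have muB := lebesgue_gt0_of_irreducible mpi pi0 q_density hP irr mB psiB.
(* From [C], one step stays in the ball of radius [`|rad| + cq], where the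
   potential is at most [um]. *)
set cq := `|cq0|.
have hcq' y : cq < enorm y -> q y = 0.
  by move=> h; apply: hcq; rewrite (le_trans (ler_norm _))// ltW.
have rho0 : 0 <= `|rad| + cq by apply: addr_ge0; exact: normr_ge0.
have [a [b [a0 hab]]] := pos_continuous_bounds 0 cpi pi0 rho0.
set um := Num.max 1 (- ln a).
have hum x : `|x| <= `|rad| + cq -> potential pi x <= um.
  rewrite -[x in `|x|]subr0 => /hab/andP[ax _].
  rewrite /potential /um ge_max !le_max lexx /= lerN2 ler_ln ?posrE//.
  by rewrite ax orbT.
set K := 1 + A * um `^ p.
have K1 : 1 <= K by rewrite /K lerDl mulr_ge0 ?powR_ge0// ltW.
pose C := [set x : 'rV[R]_d | enorm x < rad].
have mC : measurable C.
  rewrite (_ : C = @enorm R d @^-1` `]-oo, rad[).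
    by rewrite -[X in measurable X]setTI; exact: measurable_enorm.
  by apply/seteqP; split => x /=; rewrite in_itv/=.
have Crad x : C x -> enorm x <= `|rad|.
  by move=> /ltW/le_trans; apply; exact: ler_norm.
have [k [eps [eps01 hsurv]]] :=
  survival_lt1 cpi pi0 q_density hP `|rad| e0 delta0 qe mB muB.
set M := k%:R / eps.
have M0 : 0 <= M by rewrite divr_ge0//; case/andP: eps01 => /ltW.
have visM : forall N x, (visits P B C N x <= M%:E)%E.
  apply: (visits_le mB mC eps01) => x /Crad xrad; apply: hsurv.
  exact: le_trans (norm_le_enorm x) xrad.
have [eta [tau0 [eta0 tau01 hw]]] := time_weights s01 c0 K1 M0.
(* [G + L * visits] is the supersolution: time starts at [tau0], late enough for
   the weight [L] to be effective. *)
pose G tau x := lyapunov c s A p tau (potential pi x).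
pose L tau := eta * expR (c * tau `^ s).
(* The two constants are those required outside [C] and in [C], respectively. *)
pose omega := Num.min (c * tau0 `^ (s - 1)) (eta / 2 * expR (- (c / 4 * A `^ s * um))).
have omega0 : 0 < omega.
  rewrite lt_min mulr_gt0 ?powR_gt0//=; last by rewrite (lt_le_trans _ tau01).
  by rewrite mulr_gt0 ?expR_gt0// divr_gt0.
pose gain (j : nat) x := omega * (expR (c / 4 * (tau0 + j%:R) `^ s) *
  expR (c / 4 * A `^ s * potential pi x)).
have mG tau : measurable_fun setT (G tau) by exact: measurable_lyapunov.
have G0 tau x : 0 <= G tau x by exact: expR_ge0.
have L0 tau : 0 <= L tau by rewrite mulr_ge0 ?expR_ge0// ltW.
have gain0 j x : 0 <= gain j x.
  by apply: mulr_ge0; [exact: ltW|apply: mulr_ge0; exact: expR_ge0].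
have mgain j : measurable_fun setT (gain j).
  apply: measurable_funM => //; apply: measurable_funM => //.
  exact: measurable_expR_potential.
have tau00 : 0 < tau0 by exact: lt_le_trans tau01.
have u0 x : 0 <= potential pi x by exact: le_trans ler01 (potential_ge1 pi x).
apply: (modulated_moment_finite mB (w := omega^-1)
  (f := fun x => pi x `^ (- (c / 4 * A `^ s)))
  (r := fun k => expR (c / 4 * k%:R `^ s))
  (gain := fun j x => (gain j x)%:E)
  (Z := fun N j x => ((G (tau0 + j%:R) x)%:E
                      + (L (tau0 + j%:R))%:E * visits P B C N x)%E)
  (V := fun x => (G tau0 x + L tau0 * M)%:E) chain).
- exact: measurable_powR_comp.
- by move=> x; exact: powR_ge0.
- by move=> j; exact: expR_ge0.
- by rewrite invr_ge0 ltW.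
- by move=> j; exact/measurable_EFinP.
- by move=> j x; rewrite lee_fin.
- move=> j x; rewrite -EFinM lee_fin /gain mulrA mulVf ?gt_eqF// mul1r.
  apply: ler_pM; [exact: expR_ge0|exact: powR_ge0| |].
    rewrite ler_expR ler_pM2l//; apply: powR_monotone => //; last exact: ltW.
    by rewrite lerDr ltW.
  by apply: powRN_le_expR_potential => //; rewrite mulr_ge0// ltW.
- move=> N j; apply: emeasurable_funD; first exact/measurable_EFinP.
  by apply: measurable_funeM; exact: measurable_visits.
- by move=> N j x; rewrite adde_ge0 ?lee_fin// mule_ge0 ?lee_fin// visits_ge0.
- move=> N j x; set tau := tau0 + j%:R.
  have tauS : tau0 + j.+1%:R = tau + 1 by rewrite /tau -natr1 addrA.
  have tau0tau : tau0 <= tau by rewrite /tau lerDl.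
  have tau1 : 1 <= tau by exact: le_trans tau0tau.
  have tau_gt0 : 0 < tau by exact: lt_le_trans tau1.
  rewrite tauS.
  have mV := measurable_visits P mB mC N.
  have V0 := visits_ge0 P B C N.
  have mGE : measurable_fun setT (fun x => (G (tau + 1) x)%:E : \bar R).
    exact/measurable_EFinP.
  have -> : killed P B (fun x0 => ((G (tau + 1) x0)%:E + (L (tau + 1))%:E * visits P B C N x0)%E) x
      = (killed P B (fun x => (G (tau + 1) x)%:E) x
         + (L (tau + 1))%:E * killed P B (visits P B C N) x)%E.
    rewrite killedD//; last 3 first.
    - exact: measurable_funeM.
    - by move=> y; rewrite lee_fin.
    - by move=> y; rewrite mule_ge0 ?lee_fin.
    by rewrite killedZ.
  have kG : (killed P B (fun x => (G (tau + 1) x)%:E) x <= \int[P x]_y (G (tau + 1) y)%:E)%E.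
    by apply: killed_le_integral => // y; rewrite lee_fin.
  have kG0 : (0 <= killed P B (fun x => (G (tau + 1) x)%:E) x)%E.
    by apply: killed_ge0 => y; rewrite lee_fin.
  have kV0 : (0 <= killed P B (visits P B C N) x)%E by exact: killed_ge0.
  have kVM : (killed P B (visits P B C N) x <= M%:E)%E.
    by apply: killed_le_cst.
  rewrite /= -/(visits P B C N).
  move: (killed P B (visits P B C N) x) kV0 kVM => [t||//] //; rewrite !lee_fin => t0 tM.
  have t0M : 0 <= t <= M by rewrite t0.
  move: (killed P B (fun x => (G (tau + 1) x)%:E) x) kG kG0 => I IG I0.
  have [_ hw1 hw2] := hw tau tau0tau.
  have [xC|xC] := pselect (C x).
  + have Ix : (I <= (expR (c * (tau + K) `^ s))%:E)%E.
      apply: le_trans IG _.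
      have hG y : `|y| <= `|rad| + cq -> G (tau + 1) y <= expR (c * (tau + K) `^ s).
        move=> /hum yu; rewrite ler_expR ler_pM2l//; apply: powR_monotone; last exact: ltW.
          by rewrite addr_ge0 ?addr_ge0 ?mulr_ge0 ?powR_ge0// ltW.
        rewrite -addrA lerD2l /K lerD2l ler_pM2l//; apply: powR_monotone => //.
        exact: ltW.
      have xr : `|x| <= `|rad| by exact: le_trans (norm_le_enorm x) (Crad x xC).
      apply: (metropolis_integral_le hpi hq hP (mG _) (G0 _) (expR_ge0 _) hcq').
      - by apply: hG; rewrite (le_trans xr)// lerDl; exact: normr_ge0.
      - move=> y yc; apply: hG; rewrite (le_trans (ler_normD _ _))// lerD//.
        exact: le_trans (norm_le_enorm y) yc.
    case: I {IG} I0 Ix => [i||//] //; rewrite !lee_fin => i0 ix.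
    rewrite indicE mem_set//=.
    apply: (weighted_step_near ix _ _ (hw2 t t0M)).
      rewrite ler_expR ler_pM2l//; apply: powR_monotone; [exact: ltW| |exact: ltW].
      by rewrite lerDl mulr_ge0 ?powR_ge0// ltW.
    have uum : potential pi x <= um.
      apply: hum; have xr := le_trans (norm_le_enorm x) (Crad x xC).
      by rewrite (le_trans xr)// lerDl; exact: normr_ge0.
    have ho : omega <= eta / 2 * expR (- (c / 4 * A `^ s * um)).
      by rewrite ge_min lexx orbT.
    have a40 : 0 <= c / 4 * A `^ s by exact: mulr_ge0 (ltW k40) (ltW As0).
    exact: gain_near_le (ltW c0) (ltW eta0) a40 (powR_ge0 _ _) uum ho.
  + have xrad : rad <= enorm x by rewrite leNgt; exact/negP.
    have := drift tau x tau1 xrad; cbv zeta; set T := tau + 1 + A * potential pi x `^ p.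
    move=> dr.
    have {}dr : (I + (2 * c * T `^ (s - 1) * expR (c * T `^ s))%:E <= (G tau x)%:E)%E.
      by apply: le_trans dr; rewrite leeD2r.
    case: I {IG} I0 dr => [i||//] //; rewrite -EFinD !lee_fin => i0 dr.
    rewrite indicE memNset//= add0r.
    have DE : 2 * c * T `^ (s - 1) * expR (c * T `^ s) / 2 =
      c * T `^ (s - 1) * expR (c * T `^ s) by field.
    have [h0 _ _] := hw tau0 (lexx _).
    have [h1 _ _] := hw tau tau0tau.
    have T1 : tau + 1 <= T by rewrite /T lerDl mulr_ge0 ?powR_ge0// ltW.
    apply: (weighted_step_far dr); rewrite DE.
    * apply: le_trans (gain_le s01 sp c0 A0 tau01 tau0tau (u0 x) h0).
      have e0' : 0 <= expR (c / 4 * tau `^ s) * expR (c / 4 * A `^ s * potential pi x).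
        by rewrite -expRD expR_ge0.
      have ho : omega <= c * tau0 `^ (s - 1) by rewrite ge_min lexx.
      exact: ler_wpM2r e0' _ _ ho.
    * rewrite -mulrBr; apply: (le_trans (hw1 t t0M)).
      rewrite -[leLHS]mulrA -[leRHS]mulrA; apply: (ler_wpM2l (ltW c0)).
      apply: powR_expR_monotone => //; first by rewrite addr_gt0.
      apply: (le_trans h1).
      have tt : tau `^ s <= (tau + 1) `^ s.
        by apply: powR_monotone; [exact: ltW|rewrite lerDl|exact: ltW].
      apply: ler_pM (powR_ge0 _ _) _ tt.
        exact: mulr_ge0 (divr_ge0 (ltW c0) (ler0n _ 2)) (ltW s0).
      apply: (ler_wpM2r (ltW s0)).
      by rewrite ler_pdivrMr// ler_peMr ?ler1n// ltW.
- apply/measurable_EFinP; apply: measurable_funD => //.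
- move=> N x; rewrite addr0 EFinD (EFinM (L tau0)); apply: leeD => //.
  by apply: lee_wpmul2l; [rewrite lee_fin|exact: visM].
- set zs := 2 * c * A `^ s in lambdaV *.
  set E1 := expR (2 * c * tau0 `^ s).
  have mpz : measurable_fun setT (fun x => (pi x `^ (- zs))%:E : \bar R).
    by apply/measurable_EFinP; exact: measurable_powR_comp.
  have E10 : 0 <= E1 by exact: expR_ge0.
  set E2 := E1 * expR zs + L tau0 * M.
  have E20 : 0 <= E2.
    by apply: addr_ge0; [exact: mulr_ge0 E10 (expR_ge0 _)|exact: mulr_ge0].
  apply: (@le_lt_trans _ _ (\int[lambda]_x (E2%:E + E1%:E * (pi x `^ (- zs))%:E))%E).
    apply: ge0_le_integral => //.
    - move=> x _; rewrite lee_fin; apply: addr_ge0; first exact: G0.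
      exact: mulr_ge0.
    - by apply/measurable_EFinP; exact: measurable_funD.
    - by apply: emeasurable_funD => //; exact: measurable_funeM.
    move=> x _; rewrite -EFinM -EFinD lee_fin /E2 addrAC lerD2r -mulrDr.
    apply: (le_trans (lyapunov0_le s01 sp c0 A0 tau00 (u0 x))).
    by rewrite ler_wpM2l//; exact: expR_potential_le.
  have p0' x : (0 <= (pi x `^ (- zs))%:E :> \bar R)%E by rewrite lee_fin powR_ge0.
  rewrite ge0_integralD//; last 2 first.
  - by move=> x _; rewrite mule_ge0.
  - exact: measurable_funeM.
  rewrite integral_cst// [X in (_ * X + _)%E](@probability_setT _ _ _ lambda) mule1.
  rewrite ge0_integralZl//.
  by rewrite lte_add_pinfty ?ltry// lte_mul_pinfty.
Qed.
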